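(* Let $d\ge1$, $n\ge2$. Let $X_1,\dots,X_n$ be independent random vectors in $\mathbb{R}^d$ with $X_i\sim f_{G_i}$ for probability measures $G_1,\dots,G_n$ on $\mathbb{R}^d$, and let $\bar G_n:=(G_1+\dots+G_n)/n$. Let $\hat f_n$ be an NPMLE based on $X_1,\dots,X_n$. Then there exists a positive constant $C_d$ depending only on $d$ such that whenever $\bar G_n$ is a discrete probability measure that is supported on a set of cardinality $k$, we have $$\mathbb{E}\,\mathfrak{H}^2(\hat f_n,f_{\bar G_n})\le C_d\left(\frac kn\right)(\log n)^{d+1}.$$
   Context: $\phi_d(z):=(2\pi)^{-d/2}\exp(-\|z\|^2/2)$ is the standard normal density on $\mathbb{R}^d$. For a probability measure $G$ on $\mathbb{R}^d$, $f_G(x):=\int\phi_d(x-\theta)\,dG(\theta)$, and $\mathcal{M}$ is the class of all densities $f_G$ as $G$ ranges over all probability measures on $\mathbb{R}^d$. An NPMLE based on $X_1,\dots,X_n$ is any maximizer $\hat f_n\in\arg\max_{f\in\mathcal{M}}\frac1n\sum_{i=1}^n\log f(X_i)$ (maximizers exist but need not be unique; the result is for any of them). $\mathfrak{H}^2(f,g):=\int(\sqrt{f(x)}-\sqrt{g(x)})^2dx$ is the squared Hellinger distance. *)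

(* Defs.v *)
From HB Require Import structures.
From mathcomp Require Import all_boot all_order all_algebra.
From mathcomp Require Import all_classical all_reals all_analysis.
Set Implicit Arguments.
Unset Strict Implicit.
Unset Printing Implicit Defensive.
Import Order.TTheory GRing.Theory Num.Theory.
Import numFieldNormedType.Exports.
Local Open Scope classical_set_scope.
Local Open Scope ring_scope.

(* R^d is [d.-tuple R] with the product (hence Borel) sigma-algebra; the library
   has Lebesgue measure on R only, so Lebesgue measure on R^d is obtained by
   induction on d, transporting the binary product measure along
   (x, t) |-> x :: t. *)

Section lebesgue_cons.
Local Open Scope ereal_scope.
Context (R : realType) (n : nat).
Variable mu : {sigma_finite_measure set (n.-tuple R) -> \bar R}.

Definition tcons (p : R * n.-tuple R) : n.+1.-tuple R := [tuple of p.1 :: p.2].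

Lemma measurable_tcons : measurable_fun [set: R * n.-tuple R] tcons.
Proof.
exact: (measurable_cons measurable_fst measurable_snd).
Qed.

Definition lebesgue_cons : set (n.+1.-tuple R) -> \bar R :=
  pushforward (lebesgue_measure \x mu) tcons.

Let lebesgue_cons0 : lebesgue_cons set0 = 0.
Proof. by rewrite /lebesgue_cons /pushforward preimage_set0 measure0. Qed.

Let lebesgue_cons_ge0 A : 0 <= lebesgue_cons A.
Proof. by rewrite /lebesgue_cons /pushforward measure_ge0. Qed.

Let lebesgue_cons_sigma_additive : semi_sigma_additive lebesgue_cons.
Proof.
move=> F mF tF mUF; rewrite /lebesgue_cons /pushforward preimage_bigcup.
have m A : measurable A -> measurable (tcons @^-1` A).
  by move=> mA; rewrite -[X in measurable X]setTI; exact: measurable_tcons.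
apply: measure_semi_sigma_additive.
- by move=> i; exact: m.
- apply/trivIsetP => /= i j _ _ ij; rewrite -preimage_setI.
  by move/trivIsetP : tF => /(_ _ _ _ _ ij) ->//; rewrite preimage_set0.
- by rewrite -preimage_bigcup; exact: m.
Qed.

HB.instance Definition _ := isMeasure.Build _ _ _ lebesgue_cons
  lebesgue_cons0 lebesgue_cons_ge0 lebesgue_cons_sigma_additive.

Let lebesgue_cons_sigma_finite : sigma_finite setT lebesgue_cons.
Proof.
have /sigma_finiteP[F [FT ndF Foo]] := sigma_finiteT (@lebesgue_measure R).
have /sigma_finiteP[G [GT ndG Goo]] := sigma_finiteT mu.
pose uncons (t : n.+1.-tuple R) : R * n.-tuple R :=
  (thead t, [tuple of behead t]).
have muncons : measurable_fun setT uncons.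
  by apply: measurable_fun_pair; [exact: measurable_tnth|
                                  exact: measurable_behead].
have unconsK p : uncons (tcons p) = p.
  by case: p => x t; congr pair; exact/val_inj.
exists (fun i => uncons @^-1` (F i `*` G i)) => [|i].
  apply/seteqP; split=> // t _.
  have [k _ Fk] : (\bigcup_i F i) (thead t) by rewrite -FT.
  have [l _ Gl] : (\bigcup_i G i) [tuple of behead t] by rewrite -GT.
  exists (maxn k l) => //; split=> /=.
    by move: Fk; exact/subsetPset/ndF/leq_maxl.
  by move: Gl; exact/subsetPset/ndG/leq_maxr.
have [mFi Fioo] := Foo i; have [mGi Gioo] := Goo i.
have mFG : measurable (F i `*` G i) by exact: measurableX.
split; first by rewrite -[X in measurable X]setTI; exact: muncons.
rewrite /lebesgue_cons /pushforward -comp_preimage.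
rewrite (_ : uncons \o tcons = id); last exact/funext.
by rewrite preimage_id product_measure1E// lte_mul_pinfty// ge0_fin_numE.
Qed.

HB.instance Definition _ := Measure_isSigmaFinite.Build _ _ _ lebesgue_cons
  lebesgue_cons_sigma_finite.

End lebesgue_cons.

Fixpoint lebesgue_tuple (R : realType) (d : nat) :
    {sigma_finite_measure set (d.-tuple R) -> \bar R} :=
  match d return {sigma_finite_measure set (d.-tuple R) -> \bar R} with
  | 0%N => \d_([tuple] : 0.-tuple R)
  | m.+1 => lebesgue_cons (lebesgue_tuple R m)
  end.

Lemma lebesgue_tuple_box (R : realType) (d : nat) (A : 'I_d -> set R) :
  (forall i, measurable (A i)) ->
  lebesgue_tuple R d [set t | forall i, A i (tnth t i)] =
  (\prod_(i < d) lebesgue_measure (A i))%E.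
Proof.
elim: d A => [|d IH] A mA /=.
  by rewrite big_ord0 diracE mem_set// => -[].
rewrite big_ord_recl -IH// -product_measure1E//; last first.
  rewrite (_ : [set _ | _] =
      \bigcap_(i in [set: 'I_d]) ((fun t => tnth t i) @^-1` A (lift ord0 i))).
    apply: fin_bigcap_measurable => [|i _]; first exact: finite_finset.
    by rewrite -[X in measurable X]setTI; exact: measurable_tnth.
  by apply/seteqP; split=> [t At i _|t At i]; [exact: At|exact: At i I].
  exact: mA.
rewrite /lebesgue_cons /pushforward; congr (_ _).
apply/seteqP; split=> [[x t] /= At|[x t] /= [Ax At] i].
  split=> [|i]; first exact: (At ord0).
  by have := At (lift ord0 i); rewrite tnthS.
by have [j ->|->//] := unliftP ord0 i; rewrite tnthS; exact: At.
Qed.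

Section average_measure.
Local Open Scope ereal_scope.
Context d (T : measurableType d) (R : realType) (n : nat).
Variable G : 'I_n -> probability T R.

Definition average_measure (A : set T) : \bar R :=
  (n%:R^-1 : R)%R%:E * \sum_(i < n) G i A.

Let G' (k : nat) : {measure set T -> \bar R} :=
  if insub k is Some i then G i else mzero.

Let average_measureE :
  average_measure = @mscale _ T R (n%:R^-1)%:nng%R (msum G' n).
Proof.
apply/funext => A; congr (_ * _); apply: eq_bigr => i _.
by rewrite /G' valK.
Qed.

Let average_measure0 : average_measure set0 = 0.
Proof. by rewrite average_measureE measure0. Qed.

Let average_measure_ge0 A : 0 <= average_measure A.
Proof. by rewrite average_measureE measure_ge0. Qed.

Let average_measure_sigma_additive : semi_sigma_additive average_measure.
Proof. by rewrite average_measureE; exact: measure_semi_sigma_additive. Qed.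

HB.instance Definition _ := isMeasure.Build _ _ _ average_measure
  average_measure0 average_measure_ge0 average_measure_sigma_additive.

Lemma average_measure_setT : (0 < n)%N -> average_measure setT = 1.
Proof.
move=> n0; rewrite /average_measure.
under eq_bigr do rewrite probability_setT.
rewrite sumEFin -EFinM big_const_ord iter_addr_0 -(mulr_natl 1) mulr1.
by rewrite mulVf// pnatr_eq0 -lt0n.
Qed.

End average_measure.

Definition std_normal_pdf (R : realType) (d : nat) (z : d.-tuple R) : R :=
  (2 * pi) `^ (- (d%:R / 2)) * expR (- (\sum_(i < d) tnth z i ^+ 2) / 2).

Definition tuple_sub (R : realType) (d : nat) (x y : d.-tuple R) : d.-tuple R :=
  [tuple tnth x i - tnth y i | i < d].

Definition gauss_mixture (R : realType) (d : nat)
    (G : {measure set (d.-tuple R) -> \bar R}) (x : d.-tuple R) : R :=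
  \int[G]_theta std_normal_pdf (tuple_sub x theta).

Definition gauss_mixtures (R : realType) (d : nat) : set (d.-tuple R -> R) :=
  [set f | exists G : probability (d.-tuple R) R, f = gauss_mixture G].

Definition avg_loglik (R : realType) (d n : nat) (x : 'I_n -> d.-tuple R)
    (f : d.-tuple R -> R) : R :=
  n%:R^-1 * \sum_(i < n) ln (f (x i)).

Definition is_npmle (R : realType) (d n : nat) (x : 'I_n -> d.-tuple R)
    (f : d.-tuple R -> R) : Prop :=
  gauss_mixtures f /\
  forall g, gauss_mixtures g -> avg_loglik x g <= avg_loglik x f.

Definition hellinger2 (R : realType) (d : nat) (f g : d.-tuple R -> R) : \bar R :=
  (\int[lebesgue_tuple R d]_x ((Num.sqrt (f x) - Num.sqrt (g x)) ^+ 2)%:E)%E.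

Definition has_density (R : realType) (d : nat) (dO : measure_display)
    (Omega : measurableType dO) (P : probability Omega R)
    (X : {RV P >-> d.-tuple R}) (f : d.-tuple R -> R) : Prop :=
  forall A, measurable A ->
    distribution P X A = (\int[lebesgue_tuple R d]_(x in A) (f x)%:E)%E.

Definition independent_RVs (R : realType) (dO dT : measure_display)
    (Omega : measurableType dO) (T : measurableType dT) (P : probability Omega R)
    (n : nat) (X : 'I_n -> {RV P >-> T}) : Prop :=
  forall (J : {set 'I_n}) (A : 'I_n -> set T), (forall i, measurable (A i)) ->
    P (\bigcap_(i in [set` J]) (X i @^-1` A i)) =
    (\prod_(i in J) P (X i @^-1` A i))%E.

(* Main.v *)
Require Import Defs.
From HB Require Import structures.
From mathcomp Require Import all_boot all_order all_algebra.
From mathcomp Require Import all_classical all_reals all_analysis.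
From mathcomp Require Import measurable_realfun ring lra.
Set Implicit Arguments.
Unset Strict Implicit.
Unset Printing Implicit Defensive.
Import Order.TTheory GRing.Theory Num.Theory.
Import numFieldNormedType.Exports.
Local Open Scope classical_set_scope.
Local Open Scope ring_scope.

(** Write L = ln n, f0 for the average density (1/n) sum_i f_(G_i), and B for
    the union of the k cubes of half side M = sqrt (8 L) around the atoms of
    the average mixing measure.

    Reduction to a finite net.  Suppose that finitely many mixtures z_t,
    t in I, approximate every mixture up to eta on B, uniformly.  Put
    h_t = z_t + eta and rho_t = int_B sqrt (h_t f0).  When every X_i falls in
    B, the maximality of the likelihood at fhat and fhat <= h_t on B, for the
    index t attached to fhat, give prod_i sqrt (h_t / f0) (X_i) >= 1.  For a
    fixed t, independence and the inequality 1 + u <= exp u yield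
      E prod_i (1_B sqrt (h_t / f0)) (X_i) <= exp (sum_i (a_i - 1)),
    where a_i is the expectation of the i-th factor and
    sum_i a_i = n rho_t: only the average of the laws of the X_i enters, so
    these laws need not agree.  Summing over t the products divided by
    exp (n (rho_t - 1)) gives a random variable W with E W <= #|I|, and W is at
    least exp (n (1 - rho_t)) for the data-dependent index t.  By tangency of
    the exponential,
      n (1 - rho_t) <= ln #|I| - 1 + W / #|I|,
    while 1 - rho_t controls half of the squared Hellinger distance up to a
    term of order n eta |B| + 1/n.  Taking expectations, the risk is at most of
    order (ln #|I| + 1) / n + n eta |B| + n int_(~B) f0
    ([hellinger_risk_net]).

    Size of the net.  For |x| <= M the kernel exp (- (x - t)^2 / 2) is, up to
    exp (- M^2 / 2) = n^-4 and uniformly in t, a sum of D = O(L) products of a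
    function of x and a function of t bounded by 1: expand exp (x t) in its
    power series when |t| <= 2 M, and use 0 when |t| > 2 M
    ([gauss_kernel_expansion]).  In dimension d and near one atom, a mixture is
    thus determined up to O(n^-4) by D^d moments in [-1, 1]; rounding them
    to multiples of a fixed power of 1/n leaves at most n^O(1) values for each.
    Choosing one mixture for each pattern of the k D^d rounded moments
    gives a net with ln #|I| = O(k L^(d+1)) and eta = O(n^-4)
    ([gauss_mixture_net]).

    Outside B the density f0 has mass O(n^-2)
    ([integral_gauss_mixture_tail]), and |B| <= k (2 M)^d, so every term is
    O((k / n) L^(d+1)) ([npmle_rate_le]). *)

(** * Integration and independence *)

Section measure_theory.
Local Open Scope ereal_scope.
Context (R : realType).

Import HBNNSimple.

(** The integral of a nonnegative function is a supremum over simple functions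
    below it, so it is monotone even at non-measurable functions; an estimator
    chosen among several maximizers need not depend measurably on the sample. *)
Lemma ge0_le_integral_lower d (T : measurableType d)
    (mu : {measure set T -> \bar R}) (f g : T -> \bar R) :
  (forall x, 0 <= f x) -> (forall x, f x <= g x) ->
  \int[mu]_x f x <= \int[mu]_x g x.
Proof.
move=> f0 fg; have g0 x : 0 <= g x by exact: le_trans (f0 x) (fg x).
rewrite !ge0_integralTE//; apply: ereal_sup_le => _ [h hf <-].
by exists h => //= x; exact: le_trans (hf x) (fg x).
Qed.

(** Two laws that agree on indicators agree on nonnegative measurable functions,
    by monotone approximation. With X the identity and W a density, this turns
    an expectation into an integral against the density; with W the product of
    the other factors, it replaces one indicator by a function in a product
    formula. *)
Lemma ge0_integral_weighted_law d d' (O : measurableType d)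
    (T : measurableType d') (P : {measure set O -> \bar R})
    (m : {measure set T -> \bar R}) (X : O -> T) (W : O -> R)
    (g : T -> \bar R) :
  measurable_fun setT X -> measurable_fun setT W -> (forall w, (0 <= W w)%R) ->
  (forall A, measurable A -> \int[P]_w ((\1_A (X w))%:E * (W w)%:E) = m A) ->
  measurable_fun setT g -> (forall x, 0 <= g x) ->
  \int[P]_w (g (X w) * (W w)%:E) = \int[m]_x g x.
Proof.
move=> mX mW W0 PWm mg g0.
have mWE : measurable_fun setT (fun w => (W w)%:E) by exact/measurable_EFinP.
pose f_ := nnsfun_approx measurableT mg.
have mfX n : measurable_fun setT (fun w => (f_ n (X w))%:E * (W w)%:E).
  apply: emeasurable_funM => //; apply/measurable_EFinP.
  by apply: measurableT_comp.
have intf n : \int[P]_w ((f_ n (X w))%:E * (W w)%:E) = \int[m]_x (f_ n x)%:E.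
  have mA r : measurable (f_ n @^-1` [set r]) by [].
  under eq_integral.
    move=> w _; rewrite fimfunE -fsumEFin// ge0_mule_fsuml; last first.
      by move=> r; rewrite EFinM nnfun_muleindic_ge0.
    over.
  have mAX r : measurable_fun setT
      (fun w => (\1_(f_ n @^-1` [set r]) (X w) : R)%:E * (W w)%:E).
    apply: emeasurable_funM => //; apply/measurable_EFinP.
    by apply: measurableT_comp.
  rewrite ge0_integral_fsum//; last 2 first.
  - move=> r; under eq_fun do rewrite EFinM -muleA.
    exact: emeasurable_funM.
  - by move=> r w _; rewrite mule_ge0 ?nnfun_muleindic_ge0// lee_fin.
  under [RHS]eq_integral do rewrite fimfunE -fsumEFin//.
  rewrite ge0_integral_fsum//; last 2 first.
  - move=> r; under eq_fun do rewrite EFinM.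
    by apply: emeasurable_funM => //; apply/measurable_EFinP.
  - by move=> r w _; rewrite EFinM nnfun_muleindic_ge0.
  apply: eq_fsbigr => r _.
  have [r0|r0] := leP 0%R r; last first.
    have A0 : f_ n @^-1` [set r] = set0.
      apply/seteqP; split => // x /= fxr.
      by have : (0 <= f_ n x)%R by []; rewrite fxr leNgt r0.
    rewrite !integral0_eq// => x _; first by rewrite A0 indic0 mulr0.
    by rewrite A0 indic0 mulr0 mul0e.
  under eq_integral do rewrite EFinM -muleA.
  under [RHS]eq_integral do rewrite EFinM.
  rewrite !ge0_integralZl//.
  - by rewrite PWm// integral_indic// setIT.
  - by move=> x _; rewrite mule_ge0// lee_fin.
  - exact/measurable_EFinP.
have f_nd x : nondecreasing_seq (f_ ^~ x).
  by move=> a b ab; exact/lefP/nd_nnsfun_approx.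
transitivity (limn (fun n => \int[P]_w ((f_ n (X w))%:E * (W w)%:E))).
  rewrite -monotone_convergence//.
  - apply: eq_integral => w _; apply/esym/cvg_lim => //.
    apply: cvgeZr => //.
    by apply: (@cvg_nnsfun_approx _ _ _ _ measurableT _ mg) => // y.
  - by move=> n w _; rewrite mule_ge0// lee_fin.
  - by move=> w _ a b ab; rewrite lee_wpmul2r ?lee_fin//; exact: f_nd.
under eq_fun do rewrite intf.
rewrite -monotone_convergence//.
- apply: eq_integral => x _; apply/cvg_lim => //.
  by apply: (@cvg_nnsfun_approx _ _ _ _ measurableT _ mg) => // y.
- by move=> n; apply/measurable_EFinP.
- by move=> n w _; rewrite lee_fin.
- by move=> w _ a b ab; rewrite lee_fin; exact: f_nd.
Qed.

Lemma integral_indic_RV dO dT (O : measurableType dO)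
    (T : measurableType dT) (P : probability O R) (X : {RV P >-> T}) A :
  measurable A -> \int[P]_w (\1_A (X w))%:E = P (X @^-1` A).
Proof.
move=> mA; rewrite -[X @^-1` A]setIT -integral_indic//.
by rewrite -[X in measurable X]setTI; exact: measurable_funPT.
Qed.

(** Independence is the product rule for indicators; the indicators are replaced
    by the functions g i one index at a time. *)
Lemma integral_prod_independent dO dT (O : measurableType dO)
    (T : measurableType dT) (P : probability O R) n
    (X : 'I_n -> {RV P >-> T}) (g : 'I_n -> T -> R) :
  independent_RVs X ->
  (forall i, measurable_fun setT (g i)) -> (forall i x, (0 <= g i x)%R) ->
  (forall i, \int[P]_w (g i (X i w))%:E < +oo) ->
  \int[P]_w (\prod_i g i (X i w))%:E = \prod_i \int[P]_w (g i (X i w))%:E.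
Proof.
move=> indepX mg g0 gfin.
(* s lists the indices at which the replacement has been made *)
pose h (s : seq 'I_n) (A : 'I_n -> set T) i : T -> R := if i \in s then g i else \1_(A i).
suff H s A : (forall i, measurable (A i)) ->
    \int[P]_w (\prod_i h s A i (X i w))%:E =
    \prod_i \int[P]_w (h s A i (X i w))%:E.
  have hE i : h (enum 'I_n) (fun=> setT) i = g i by rewrite /h mem_enum.
  have := H (enum 'I_n) (fun=> setT) (fun=> measurableT).
  under eq_integral do under eq_bigr do rewrite hE.
  by under [X in _ = X -> _]eq_bigr do rewrite hE.
have mh s' A' i : (forall i, measurable (A' i)) ->
    measurable_fun setT (h s' A' i).
  by move=> mA'; rewrite /h; case: ifP => _ //; exact: measurable_indic.
have h0 s' A' i x : (0 <= h s' A' i x)%R by rewrite /h; case: ifP.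
have hfin s' A' i : (forall i, measurable (A' i)) ->
    \int[P]_w (h s' A' i (X i w))%:E < +oo.
  move=> mA'; rewrite /h; case: ifP => _ //.
  rewrite integral_indic_RV// -ge0_fin_numE//.
  apply: fin_num_measure.
  by rewrite -[X in measurable X]setTI; exact: measurable_funPT.
elim: s A => [|i0 s IH] A mA.
  rewrite (_ : \int[P]_w _ = P (\bigcap_(i in [set` [set: 'I_n]%SET])
    (X i @^-1` A i))); last first.
    rewrite -[\bigcap_(i in _) _]setIT -integral_indic//; last first.
      apply: fin_bigcap_measurable => // i _.
      by rewrite -[X in measurable X]setTI; exact: measurable_funPT.
    apply: eq_integral => w _; congr EFin.
    rewrite indicE; have [Aw|Aw] := pselect (forall i, A i (X i w)).
      rewrite mem_set//; last by move=> i _; exact: Aw.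
      by rewrite big1// => i _; rewrite /h/= indicE mem_set.
    have /existsNP[i Ai] := Aw.
    rewrite memNset; last by move=> /(_ i); rewrite /= inE => /(_ isT).
    by apply/eqP/prodf_eq0; exists i => //; rewrite /h/= indicE memNset.
  rewrite (indepX [set: 'I_n]%SET A mA).
  rewrite (eq_bigl xpredT); last by move=> i; rewrite inE.
  apply: eq_bigr => i _; rewrite /h/= integral_indic_RV//.
have [i0s|i0s] := boolP (i0 \in s).
  have hE i : h (i0 :: s) A i = h s A i.
    by rewrite /h inE; case: eqP => // ->; rewrite i0s.
  under eq_integral do under eq_bigr do rewrite hE.
  by under [RHS]eq_bigr do rewrite hE; exact: IH.
pose A' B i := if i == i0 then B else A i.
have mA' B : measurable B -> forall i, measurable (A' B i).
  by move=> mB i; rewrite /A'; case: ifP.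
have h'E B i : i != i0 -> h (i0 :: s) A i = h s (A' B) i.
  by move=> ii0; rewrite /h /A' inE (negbTE ii0).
have h'i0 B : h s (A' B) i0 = \1_B by rewrite /h (negbTE i0s) /A' eqxx.
pose W w := (\prod_(i | i != i0) h (i0 :: s) A i (X i w))%R.
pose c := (\prod_(i | i != i0) fine (\int[P]_w (h (i0 :: s) A i (X i w))%:E))%R.
have efin i : \int[P]_w (h (i0 :: s) A i (X i w))%:E \is a fin_num.
  by rewrite ge0_fin_numE ?hfin// integral_ge0// => w _; rewrite lee_fin.
have c0 : (0 <= c)%R.
  by apply: prodr_ge0 => i _; rewrite fine_ge0// integral_ge0// => w _; rewrite lee_fin.
have cE : c%:E = \prod_(i | i != i0) \int[P]_w (h (i0 :: s) A i (X i w))%:E.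
  by rewrite -prodEFin; apply: eq_bigr => i _; rewrite fineK.
rewrite [RHS](bigD1 i0)//= -cE.
under eq_integral do rewrite (bigD1 i0)//= -/(W _) EFinM.
(* as a function of the i0-th factor, both sides are integrals against the law
   of X i0, scaled by the product c of the other expectations *)
pose m := mscale (NngNum c0) (distribution P (X i0)).
have hi0 : h (i0 :: s) A i0 = g i0 by rewrite /h inE eqxx.
rewrite hi0 (@ge0_integral_weighted_law _ _ _ _ P m (X i0) W (EFin \o g i0))//.
- rewrite ge0_integral_mscale//; last 2 first.
  + exact/measurable_EFinP.
  + by move=> x _; rewrite lee_fin.
  rewrite muleC ge0_integral_distribution//.
  + exact/measurable_EFinP.
  + by move=> x; rewrite lee_fin.
- rewrite /W; under eq_fun do rewrite -big_filter.
  apply: measurable_prod => i _; apply: measurableT_comp => //.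
  exact: mh.
- by move=> w; apply: prodr_ge0 => i _.
- move=> B mB.
  transitivity (\int[P]_w (\prod_i h s (A' B) i (X i w))%:E).
    apply: eq_integral => w _; rewrite [in RHS](bigD1 i0)//= h'i0 EFinM.
    by congr (_ * _%:E); apply: eq_bigr => i ii0; rewrite (h'E B).
  rewrite (IH _ (mA' _ mB)) (bigD1 i0)//= h'i0 integral_indic_RV//.
  rewrite /m /mscale/= muleC cE; congr (_ * _).
  by apply: eq_bigr => i ii0; rewrite (h'E B).
- exact/measurable_EFinP.
- by move=> x; rewrite /= lee_fin.
Qed.
End measure_theory.

(** * Hellinger distance and the likelihood ratio *)

Section hellinger.
Local Open Scope ereal_scope.
Context (R : realType) d (T : measurableType d) (mu : {measure set T -> \bar R}).

Lemma measurable_sqrtr : measurable_fun [set: R] (@Num.sqrt R).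
Proof. by apply: continuous_measurable_fun; exact: sqrt_continuous. Qed.

(** The square root is subadditive, and sqrt (2 e b) is the geometric mean of
    2 c e and b / c; the weight c is later the sample size. *)
Lemma sqrtr_shift_le (a b e c : R) :
  (0 <= a)%R -> (0 <= b)%R -> (0 <= e)%R -> (0 < c)%R ->
  (Num.sqrt ((a + 2 * e) * b) <=
   Num.sqrt (a * b) + (c * e + b / (2 * c)))%R.
Proof.
move=> a0 b0 e0 c0; have c_ge0 := ltW c0.
set q := (_ + _ / _)%R.
have q0 : (0 <= q)%R by rewrite addr_ge0 ?mulr_ge0 ?invr_ge0 ?mulr_ge0.
have -> : (Num.sqrt (a * b) + q = Num.sqrt ((Num.sqrt (a * b) + q) ^+ 2))%R.
  by rewrite sqrtr_sqr ger0_norm// addr_ge0.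
apply: ler_wsqrtr.
rewrite sqrrD sqr_sqrtr ?mulr_ge0//.
have : (2 * e * b <= q ^+ 2)%R.
  have -> : (2 * e * b = q ^+ 2 - (c * e - b / (2 * c)) ^+ 2)%R.
    by rewrite /q; field; rewrite gt_eqF.
  by rewrite lerBlDr lerDl sqr_ge0.
have : (0 <= Num.sqrt (a * b) * q *+ 2)%R by rewrite mulrn_wge0// mulr_ge0.
by rewrite mulrDl; lra.
Qed.

Lemma prod_sqrtr (J : finType) (a : J -> R) : (forall j, 0 <= a j)%R ->
  (\prod_j Num.sqrt (a j) = Num.sqrt (\prod_j a j))%R.
Proof.
move=> a0; suff [] : (0 <= \prod_j a j)%R /\
  (\prod_j Num.sqrt (a j) = Num.sqrt (\prod_j a j))%R by [].
apply: (big_ind2 (fun x y => 0 <= x /\ y = Num.sqrt x)%R) => //.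
  by rewrite sqrtr1.
by move=> x1 x2 y1 y2 [x10 ->] [y10 ->]; rewrite mulr_ge0// sqrtrM.
Qed.

(** Expanding the square gives mass f + mass p - 2 affinity; discarding the
    affinity outside B only weakens the bound. *)
Lemma hellinger_affinity (f p : T -> R) (B : set T) :
  measurable B -> measurable_fun setT f -> measurable_fun setT p ->
  (forall x, (0 <= f x)%R) -> (forall x, (0 <= p x)%R) ->
  \int[mu]_x (f x)%:E <= 1 -> \int[mu]_x (p x)%:E <= 1 ->
  \int[mu]_x ((Num.sqrt (f x) - Num.sqrt (p x)) ^+ 2)%:E +
    2%:E * \int[mu]_x (\1_B x * Num.sqrt (f x * p x))%:E <= 2%:E.
Proof.
move=> mB mf mp f0 p0 f1 p1.
have msqf : measurable_fun setT (fun x => Num.sqrt (f x)).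
  exact: measurableT_comp measurable_sqrtr mf.
have msqp : measurable_fun setT (fun x => Num.sqrt (p x)).
  exact: measurableT_comp measurable_sqrtr mp.
have m1 : measurable_fun setT
    (fun x => ((Num.sqrt (f x) - Num.sqrt (p x)) ^+ 2)%:E).
  by apply/measurable_EFinP/measurable_funX/measurable_funB.
have m2 : measurable_fun setT (fun x => (\1_B x * Num.sqrt (f x * p x))%:E).
  apply/measurable_EFinP; apply: measurable_funM; first exact: measurable_indic.
  by apply: measurableT_comp measurable_sqrtr _; exact: measurable_funM.
have s0 x : (0 <= \1_B x * Num.sqrt (f x * p x))%R by rewrite mulr_ge0.
rewrite -ge0_integralZl//.
rewrite -ge0_integralD//; last 2 first.
- by move=> x _; rewrite lee_fin sqr_ge0.
- exact: measurable_funeM.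
apply: (@le_trans _ _ (\int[mu]_x ((f x)%:E + (p x)%:E))); last first.
  rewrite ge0_integralD//; last 4 first.
  - by move=> x _; rewrite lee_fin.
  - exact/measurable_EFinP.
  - by move=> x _; rewrite lee_fin.
  - exact/measurable_EFinP.
  rewrite (_ : 2%:E = 1 + 1); last by rewrite -EFinD.
  exact: leeD.
apply: ge0_le_integral_lower => x.
  by rewrite adde_ge0// ?mule_ge0// lee_fin ?sqr_ge0.
rewrite -EFinM -!EFinD lee_fin sqrrB !sqr_sqrtr// sqrtrM//.
have [xB|xB] := boolP (x \in B); rewrite indicE ?xB ?(negbTE xB)/=.
  by rewrite -mulr_natl; lra.
rewrite mul0r mulr0 addr0.
have : (0 <= Num.sqrt (f x) * Num.sqrt (p x))%R by rewrite mulr_ge0.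
by rewrite -mulr_natl; lra.
Qed.

End hellinger.

Section npmle_risk.
Local Open Scope ereal_scope.
Context (R : realType) dO dT (O : measurableType dO) (T : measurableType dT).
Context (P : probability O R) (mu : {measure set T -> \bar R}).

Lemma integral_density (X : {RV P >-> T}) (p g : T -> R) :
  measurable_fun setT p -> (forall x, (0 <= p x)%R) ->
  (forall A, measurable A ->
     distribution P X A = \int[mu]_(x in A) (p x)%:E) ->
  measurable_fun setT g -> (forall x, (0 <= g x)%R) ->
  \int[P]_w (g (X w))%:E = \int[mu]_x (g x * p x)%:E.
Proof.
move=> mp p0 pX mg g0.
rewrite -(@ge0_integral_distribution _ _ _ _ _ _ X (EFin \o g))//; last first.
  exact/measurable_EFinP.
under [RHS]eq_integral do rewrite EFinM.
rewrite (@ge0_integral_weighted_law _ _ _ _ _ mu (distribution P X) id p (EFin \o g))//.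
- move=> A mA; rewrite [RHS](pX _ mA) [in RHS]integral_mkcond; apply: eq_integral => x _.
  by rewrite patchE indicE; case: ifPn => _; rewrite ?mul1e ?mul0e.
- exact/measurable_EFinP.
Qed.

Variables (n : nat) (X : 'I_n -> {RV P >-> T}) (p : 'I_n -> T -> R).
Variables (f0 : T -> R) (B : set T).
Hypothesis n_gt0 : (0 < n)%N.
Hypothesis indepX : independent_RVs X.
Hypothesis mp : forall i, measurable_fun setT (p i).
Hypothesis p_ge0 : forall i x, (0 <= p i x)%R.
Hypothesis pX : forall i A, measurable A ->
  distribution P (X i) A = \int[mu]_(x in A) (p i x)%:E.
Hypothesis f0E : forall x, (n%:R * f0 x = \sum_i p i x)%R.
Hypothesis mf0 : measurable_fun setT f0.
Hypothesis f0_gt0 : forall x, (0 < f0 x)%R.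
Hypothesis mB : measurable B.

Let nR_gt0 : (0 < n%:R :> R)%R. Proof. by rewrite ltr0n. Qed.
Let f0_ge0 x : (0 <= f0 x)%R. Proof. exact/ltW. Qed.

(** Only the average density matters in a sum of expectations; this is how
    observations with different laws are compared with f0 alone. *)
Lemma sum_integral_average (g : T -> R) :
  measurable_fun setT g -> (forall x, (0 <= g x)%R) ->
  \sum_i \int[P]_w (g (X i w))%:E = n%:R%:E * \int[mu]_x (g x * f0 x)%:E.
Proof.
move=> mg g0.
under eq_bigr => i _ do rewrite (integral_density (mp i) (@p_ge0 i) (@pX i) mg g0).
rewrite -ge0_integral_sum//; last 2 first.
- by move=> i; apply/measurable_EFinP/measurable_funM.
- by move=> i x _; rewrite lee_fin mulr_ge0.
rewrite -ge0_integralZl//; last 2 first.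
- by apply/measurable_EFinP/measurable_funM.
- by move=> x _; rewrite lee_fin mulr_ge0.
apply: eq_integral => x _; rewrite sumEFin -mulr_sumr -f0E -EFinM.
by congr EFin; ring.
Qed.

Lemma integral_average_density : \int[mu]_x (f0 x)%:E = 1.
Proof.
have := @sum_integral_average (cst 1%R) (measurable_cst _) (fun=> ler01).
have P1 i : \int[P]_w (cst 1%R (X i w))%:E = 1.
  by rewrite [LHS](integral_cst P measurableT 1) mul1e; exact: probability_setT.
under eq_bigr do rewrite P1.
under eq_integral do rewrite mul1r.
rewrite sumEFin big_const_ord iter_addr_0 -[(1 *+ n)%R]mulr1 EFinM.
move=> /(congr1 (fun z => (n%:R^-1)%:E * z)); rewrite !muleA -!EFinM.
by rewrite mulr1 mulVf ?gt_eqF// !mul1e => <-.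
Qed.

Lemma sum_prob_outside :
  \sum_i P (X i @^-1` ~` B) = n%:R%:E * \int[mu]_(x in ~` B) (f0 x)%:E.
Proof.
have mCB : measurable (~` B) by exact: measurableC.
under eq_bigr do rewrite -integral_indic_RV//.
rewrite (@sum_integral_average \1_(~` B))//.
congr (_ * _); rewrite [in RHS]integral_mkcond; apply: eq_integral => x _.
by rewrite patchE indicE; case: ifPn => _; rewrite ?mul1r ?mul0r.
Qed.

Let g (h : T -> R) x := (\1_B x * Num.sqrt (h x / f0 x))%R.
Let rho (h : T -> R) := \int[mu]_x (\1_B x * Num.sqrt (h x * f0 x))%:E.

Lemma measurable_lr (h : T -> R) :
  measurable_fun setT h -> measurable_fun setT (g h).
Proof.
move=> mh.
apply: measurable_funM; first exact: measurable_indic.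
apply: (measurableT_comp (@measurable_sqrtr R)); apply: measurable_funM => //.
under eq_fun do rewrite -powR_inv1//.
exact: (measurableT_comp (measurable_powR _)).
Qed.

(** The expectations a i of the factors add up to n times the affinity of h and
    f0 on B, and a i <= exp (a i - 1) turns their product into the exponential
    of that sum. *)
Lemma integral_lr_prod (h : T -> R) :
  measurable_fun setT h -> (forall x, (0 <= h x)%R) -> rho h < +oo ->
  \int[P]_w (\prod_i g h (X i w))%:E <=
    (expR (n%:R * (fine (rho h) - 1)))%:E.
Proof.
move=> mh h0 rhoy.
have mg := measurable_lr mh.
have g0 x : (0 <= g h x)%R by rewrite mulr_ge0.
have rho0 : 0 <= rho h.
  by apply: integral_ge0 => x _; rewrite lee_fin mulr_ge0.
have sumg : \sum_i \int[P]_w (g h (X i w))%:E = n%:R%:E * rho h.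
  rewrite sum_integral_average//; congr (_ * _).
  apply: eq_integral => x _; rewrite /g -mulrA; congr (_ * _)%:E.
  rewrite !sqrtrM// sqrtrV// -[X in (_ * X)%R = _](sqr_sqrtr (f0_ge0 x)).
  by field; rewrite gt_eqF// sqrtr_gt0.
have gi0 i : 0 <= \int[P]_w (g h (X i w))%:E.
  by apply: integral_ge0 => w _; rewrite lee_fin.
have gfin i : \int[P]_w (g h (X i w))%:E < +oo.
  apply: (@le_lt_trans _ _ (\sum_i \int[P]_w (g h (X i w))%:E)).
    by rewrite (bigD1 i)//= leeDl// sume_ge0.
  by rewrite sumg lte_mul_pinfty// ?lee_fin.
rewrite (@integral_prod_independent _ _ _ _ _ _ _ X (fun=> g h))//.
pose a i := fine (\int[P]_w (g h (X i w))%:E).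
have aE i : \int[P]_w (g h (X i w))%:E = (a i)%:E.
  by rewrite fineK// ge0_fin_numE.
under eq_bigr do rewrite aE.
rewrite prodEFin lee_fin.
have -> : (n%:R * (fine (rho h) - 1) = \sum_i (a i - 1))%R.
  rewrite sumrB big_const_ord iter_addr_0 mulrBr mulr1; congr (_ - _)%R.
  apply: EFin_inj; rewrite EFinM fineK ?ge0_fin_numE// -sumg -sumEFin.
  by apply: eq_bigr => i _; rewrite aE.
rewrite expR_sum; apply: ler_prod => i _.
rewrite fine_ge0//=.
by have := expR_ge1Dx (a i - 1)%R; rewrite addrC subrK.
Qed.

(** The maximizer depends on the data, so the bound of [integral_lr_prod] is
    summed over a finite net: the sum W of the normalized likelihood ratios has
    expectation at most #|I|, and its logarithm controls n times the Hellinger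
    distance. Observations outside B are paid for by the trivial bound 2. *)
Theorem hellinger_risk_net (F : set (T -> R)) (I : finType)
    (zeta : I -> T -> R) (eta v b : R) (fhat : O -> T -> R) :
  (forall f, F f -> [/\ measurable_fun setT f, forall x, (0 < f x)%R &
                        \int[mu]_x (f x)%:E <= 1]) ->
  (forall t, F (zeta t)) -> (0 <= eta)%R ->
  (forall f, F f -> exists t, forall x, B x -> (`|f x - zeta t x| <= eta)%R) ->
  mu B <= v%:E -> \int[mu]_(x in ~` B) (f0 x)%:E <= b%:E ->
  (forall w, F (fhat w)) ->
  (forall w, \prod_i f0 (X i w) <= \prod_i fhat w (X i w))%R ->
  \int[P]_w \int[mu]_x ((Num.sqrt (fhat w x) - Num.sqrt (f0 x)) ^+ 2)%:E <=
  (2 * n%:R * b + 2 * n%:R * eta * v + n%:R^-1 +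
     2 / n%:R * (ln #|I|%:R + 1))%:E.
Proof.
move=> FP zetaF eta0 net muB tailB fhatF lik.
have v0 : (0 <= v)%R by rewrite -lee_fin (le_trans _ muB).
have mzeta t : measurable_fun setT (zeta t) by case: (FP _ (zetaF t)).
have zeta0 t x : (0 < zeta t x)%R by case: (FP _ (zetaF t)).
pose h t x := (zeta t x + eta)%R.
have mh t : measurable_fun setT (h t) by exact: measurable_funD.
have h0 t x : (0 < h t x)%R by rewrite ltr_wpDr.
have mind : measurable_fun setT (\1_B : T -> R) by exact: measurable_indic.
have intB c : (0 <= c)%R -> \int[mu]_x (c * \1_B x)%:E <= (c * v)%:E.
  move=> c0; under eq_integral do rewrite EFinM.
  rewrite ge0_integralZl//; last exact/measurable_EFinP.
  by rewrite integral_indic// setIT EFinM lee_wpmul2l// lee_fin.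
have mrho (f : T -> R) : measurable_fun setT f ->
    measurable_fun setT (fun x => (\1_B x * Num.sqrt (f x * f0 x))%:E).
  move=> mf; apply/measurable_EFinP; apply: measurable_funM => //.
  by apply: (measurableT_comp (@measurable_sqrtr R)); exact: measurable_funM.
have rho0 f : 0 <= rho f.
  by apply: integral_ge0 => x _; rewrite lee_fin mulr_ge0.
pose s := (n%:R * eta * v + (2 * n%:R)^-1)%R.
(* enlarging f by 2 eta on B raises the affinity by at most s *)
have rhoD (f k : T -> R) : measurable_fun setT f -> measurable_fun setT k ->
    (forall x, (0 <= f x)%R) ->
    (forall x, B x -> (k x <= f x + 2 * eta)%R) -> rho k <= rho f + s%:E.
  move=> mf mk f_ge0 kf.
  pose q x := (n%:R * eta * \1_B x + f0 x / (2 * n%:R))%R.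
  have q0 x : (0 <= q x)%R by rewrite addr_ge0 ?mulr_ge0 ?divr_ge0// mulr_ge0.
  apply: (@le_trans _ _ (\int[mu]_x ((\1_B x * Num.sqrt (f x * f0 x))%:E +
      ((n%:R * eta * \1_B x)%:E + (f0 x / (2 * n%:R))%:E)))).
    apply: ge0_le_integral_lower => x; first by rewrite lee_fin mulr_ge0.
    rewrite -!EFinD lee_fin indicE.
    have [/set_mem xB|xB] := boolP (x \in B); last first.
      by rewrite !(mul0r, mulr0, add0r) divr_ge0// mulr_ge0.
    rewrite !(mul1r, mulr1); apply: le_trans (sqrtr_shift_le _ _ _ nR_gt0) => //.
    by apply: ler_wsqrtr; rewrite ler_wpM2r// kf.
  have m1 : measurable_fun setT (fun x => (n%:R * eta * \1_B x)%:E).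
    by apply/measurable_EFinP; exact: measurable_funM.
  have m2 : measurable_fun setT (fun x => (f0 x / (2 * n%:R))%:E).
    by apply/measurable_EFinP; exact: measurable_funM.
  rewrite ge0_integralD//; last 3 first.
  - exact: mrho.
  - by move=> x _; rewrite -EFinD lee_fin; exact: q0.
  - exact: emeasurable_funD.
  rewrite leeD2l// ge0_integralD//; last 2 first.
  - by move=> x _; rewrite lee_fin !mulr_ge0.
  - by move=> x _; rewrite lee_fin divr_ge0// mulr_ge0.
  rewrite [s%:E]EFinD leeD ?intB ?mulr_ge0//.
  under eq_integral do rewrite mulrC EFinM.
  rewrite ge0_integralZl//; last 2 first.
  - exact/measurable_EFinP.
  - by move=> x _; rewrite lee_fin.
  by rewrite integral_average_density mule1.
have Haff f : F f ->
    \int[mu]_x ((Num.sqrt (f x) - Num.sqrt (f0 x)) ^+ 2)%:E + 2%:E * rho f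
      <= 2%:E.
  case/FP=> mf fgt0 intf; apply: hellinger_affinity => // [x|].
    exact/ltW.
  by rewrite integral_average_density.
have H0 f : 0 <= \int[mu]_x ((Num.sqrt (f x) - Num.sqrt (f0 x)) ^+ 2)%:E.
  by apply: integral_ge0 => x _; rewrite lee_fin sqr_ge0.
have H2 f : F f ->
    \int[mu]_x ((Num.sqrt (f x) - Num.sqrt (f0 x)) ^+ 2)%:E <= 2%:E.
  by move=> Ff; apply: le_trans (Haff f Ff); rewrite leeDl// mule_ge0.
have rhof1 f : F f -> rho f <= 1.
  move=> Ff; have := le_trans (leeDr _ (H0 f)) (Haff f Ff).
  by rewrite -[leRHS]mule1 lee_pmul2l.
have rhoh t : rho (h t) < +oo.
  have [mz z0 _] := FP _ (zetaF t).
  apply: (@le_lt_trans _ _ (rho (zeta t) + s%:E)).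
    apply: rhoD => // [x|x _]; first exact/ltW.
    by rewrite /h; lra.
  by apply: (@le_lt_trans _ _ (1 + s%:E)); rewrite ?leeD2r ?rhof1// -EFinD ltry.
pose r t := fine (rho (h t)).
have rE t : (r t)%:E = rho (h t) by rewrite fineK// ge0_fin_numE.
pose N := #|I|.
pose W w := (\sum_t expR (n%:R * (1 - r t)) * \prod_i g (h t) (X i w))%R.
have mg t : measurable_fun setT (g (h t)) by exact: measurable_lr.
have g0 t x : (0 <= g (h t) x)%R by rewrite mulr_ge0.
have mprod t : measurable_fun setT (fun w => \prod_i g (h t) (X i w))%R.
  by apply: measurable_prod => i _; exact: measurableT_comp.
have mterm t : measurable_fun setT
    (fun w => expR (n%:R * (1 - r t)) * \prod_i g (h t) (X i w))%R.
  exact: measurable_funM.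
have prod0 t w : (0 <= \prod_i g (h t) (X i w))%R by exact: prodr_ge0.
have term0 t w :
    (0 <= expR (n%:R * (1 - r t)) * \prod_i g (h t) (X i w))%R.
  by rewrite mulr_ge0 ?expR_ge0.
have mW : measurable_fun setT W by exact: measurable_sum.
have W0 w : (0 <= W w)%R by exact: sumr_ge0.
(* the normalization makes each summand of W have expectation at most 1 *)
have EW : \int[P]_w (W w)%:E <= N%:R%:E.
  rewrite /W; under eq_integral do rewrite -sumEFin.
  rewrite ge0_integral_sum//; last 2 first.
  - by move=> t; apply/measurable_EFinP.
  - by move=> t w _; rewrite lee_fin.
  have -> : N%:R%:E = \sum_(t : I) 1%:E :> \bar R.
    by rewrite sumEFin sumr_const.
  apply: lee_sum => t _; under eq_integral do rewrite EFinM.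
  rewrite ge0_integralZl//; last 2 first.
  - exact/measurable_EFinP.
  - by move=> w _; rewrite lee_fin.
  apply: (@le_trans _ _ ((expR (n%:R * (1 - r t)))%:E *
                         (expR (n%:R * (r t - 1)))%:E)).
    rewrite lee_wpmul2l ?lee_fin ?expR_ge0//.
    by apply: integral_lr_prod => // x; exact/ltW.
  by rewrite -EFinM -expRD -mulrDr addrA subrK subrr mulr0 expR0.
pose bad w := (\sum_i \1_(~` B) (X i w) : R)%R.
have mCB : measurable (~` B) by exact: measurableC.
have mbadi (i : 'I_n) : measurable_fun setT (fun w => \1_(~` B) (X i w) : R).
  by apply: measurableT_comp => //; exact: measurable_indic.
have mbad : measurable_fun setT bad by exact: measurable_sum.
have bad0 w : (0 <= bad w)%R by exact: sumr_ge0.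
have Ebad : \int[P]_w (bad w)%:E <= (n%:R * b)%:E.
  rewrite /bad; under eq_integral do rewrite -sumEFin.
  rewrite ge0_integral_sum//; last by move=> i; apply/measurable_EFinP.
  under eq_bigr do rewrite integral_indic_RV//.
  by rewrite sum_prob_outside EFinM lee_wpmul2l.
(* the case N = 0 is harmless: ln 0 = 0 and division by 0 gives 0 *)
have lnN0 : (0 <= ln N%:R :> R)%R.
  have [->|N0] := posnP N; first by rewrite ln0.
  by rewrite ln_ge0// ler1n.
pose c1 := (2 / n%:R / N%:R : R)%R.
pose c2 := (2 * s + 2 / n%:R * ln N%:R)%R.
have s0 : (0 <= s)%R by rewrite addr_ge0 ?invr_ge0 ?mulr_ge0.
have c10 : (0 <= c1)%R by rewrite !divr_ge0.
have c20 : (0 <= c2)%R by rewrite addr_ge0 ?mulr_ge0 ?divr_ge0.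
have Hle w :
    \int[mu]_x ((Num.sqrt (fhat w x) - Num.sqrt (f0 x)) ^+ 2)%:E <=
    (2 * bad w)%:E + ((c1 * W w)%:E + c2%:E).
  have Ff := fhatF w; have [mf fgt0 _] := FP _ Ff.
  have [allB|/existsNP[i Xi]] := pselect (forall i, B (X i w)); last first.
    apply: le_trans (H2 _ Ff) _; rewrite -!EFinD lee_fin.
    have : (1 <= bad w)%R.
      rewrite /bad (bigD1 i)//= indicE mem_set//= lerDl.
      exact: sumr_ge0.
    have : (0 <= c1 * W w)%R by rewrite mulr_ge0.
    by lra.
  have [t ft] := net _ Ff.
  have /= rt : (r t <= fine (rho (fhat w)) + s)%R.
    rewrite -lee_fin EFinD rE fineK; last first.
      by rewrite ge0_fin_numE// (le_lt_trans (rhof1 _ Ff))// ltry.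
    apply: rhoD => // [x|x /ft]; first exact/ltW.
    by rewrite ler_norml /h; lra.
  have Hrt : \int[mu]_x ((Num.sqrt (fhat w x) - Num.sqrt (f0 x)) ^+ 2)%:E <=
      (2 * (1 - r t) + 2 * s)%:E.
    have := Haff _ Ff; rewrite -[X in _ + _ * X]fineK; last first.
      by rewrite ge0_fin_numE// (le_lt_trans (rhof1 _ Ff))// ltry.
    rewrite -[X in X + _]fineK; last first.
      by rewrite ge0_fin_numE// (le_lt_trans (H2 _ Ff))// ltry.
    rewrite -EFinM -EFinD lee_fin => Hf.
    rewrite -[leLHS]fineK ?lee_fin; last first.
      by rewrite ge0_fin_numE// (le_lt_trans (H2 _ Ff))// ltry.
    lra.
  have bad_ge0 : (0 <= 2 * bad w)%R by rewrite mulr_ge0.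
  apply: le_trans Hrt _; rewrite -!EFinD lee_fin.
  have N0 : (0 < N)%N by apply/card_gt0P; exists t.
  have NR0 : (0 < N%:R :> R)%R by rewrite ltr0n.
  have lr1 : (1 <= \prod_i g (h t) (X i w))%R.
    apply: (@le_trans _ _
        (\prod_i Num.sqrt (fhat w (X i w) / f0 (X i w)))%R); last first.
      apply: ler_prod => i _; rewrite sqrtr_ge0/= /g indicE mem_set//= mul1r.
      apply: ler_wsqrtr; rewrite ler_wpM2r ?invr_ge0//.
      by have := ft _ (allB i); rewrite ler_norml /h; lra.
    rewrite prod_sqrtr; last by move=> i; rewrite divr_ge0// ltW.
    rewrite -[leLHS]sqrtr1; apply: ler_wsqrtr.
    by rewrite prodf_div ler_pdivlMr ?mul1r ?lik//; exact: prodr_gt0.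
  have Wt : (expR (n%:R * (1 - r t)) <= W w)%R.
    rewrite /W (bigD1 t)//= (le_trans (ler_peMr (expR_ge0 _) lr1))//.
    by rewrite lerDl sumr_ge0.
  (* tangent to the exponential at ln N: it bounds the exponent itself, with no
     logarithm of the random variable W *)
  have := expR_ge1Dx (n%:R * (1 - r t) - ln N%:R)%R.
  rewrite expRB lnK ?posrE// => e1.
  have n20 : (0 <= 2 / n%:R :> R)%R by rewrite divr_ge0.
  have : (2 / n%:R * (1 + (n%:R * (1 - r t) - ln N%:R)) <=
          2 / n%:R * (W w / N%:R))%R.
    rewrite ler_wpM2l//; apply: le_trans e1 _.
    by rewrite ler_wpM2r// invr_ge0.
  have -> : (2 / n%:R * (1 + (n%:R * (1 - r t) - ln N%:R)) =
     2 * (1 - r t) + 2 / n%:R - 2 / n%:R * ln N%:R)%R.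
    by field; rewrite gt_eqF.
  have -> : (2 / n%:R * (W w / N%:R) = c1 * W w)%R by rewrite /c1; ring.
  by rewrite /c2; lra.
apply: le_trans (ge0_le_integral_lower _ _ Hle) _ => //.
have mE1 : measurable_fun setT (fun w => (2 * bad w)%:E).
  by apply/measurable_EFinP; exact: measurable_funM.
have mE2 : measurable_fun setT (fun w => (c1 * W w)%:E).
  by apply/measurable_EFinP; exact: measurable_funM.
rewrite ge0_integralD//; last 3 first.
- by move=> w _; rewrite lee_fin mulr_ge0.
- by move=> w _; rewrite -EFinD lee_fin addr_ge0// mulr_ge0.
- exact: emeasurable_funD.
rewrite ge0_integralD//; last by move=> w _; rewrite lee_fin mulr_ge0.
have -> : \int[P]_w c2%:E = c2%:E.
  rewrite [LHS](integral_cst P measurableT c2%:E) -[RHS]mule1; congr (_ * _).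
  exact: probability_setT.
under eq_integral do rewrite EFinM.
under [X in _ + (X + _)]eq_integral do rewrite EFinM.
rewrite !ge0_integralZl//; last 4 first.
- exact/measurable_EFinP.
- by move=> w _; rewrite lee_fin.
- exact/measurable_EFinP.
- by move=> w _; rewrite lee_fin.
apply: (@le_trans _ _ (2%:E * (n%:R * b)%:E + ((2 / n%:R)%:E + c2%:E))).
  apply: leeD; first by rewrite lee_wpmul2l.
  rewrite leeD2r//; apply: (@le_trans _ _ (c1%:E * N%:R%:E)).
    by rewrite lee_wpmul2l.
  rewrite -EFinM lee_fin /c1; have [N0|N0] := posnP N.
    by rewrite N0 mulr0 divr_ge0.
  by rewrite divfK// gt_eqF// ltr0n.
rewrite -EFinM -!EFinD lee_fin /c2 /s -/N le_eqVlt; apply/orP; left; apply/eqP.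
by field; rewrite gt_eqF.
Qed.

End npmle_risk.

(** * A low-rank expansion of the Gaussian kernel *)

Section exp_kernel.
Context (R : realType).
Implicit Types x y t M : R.

Lemma exp_coeff_sum_le_expR y D : 0 <= y ->
  \sum_(m < D) y ^+ m / m`!%:R <= expR y.
Proof.
move=> y0; rewrite -(big_mkord xpredT (fun m => y ^+ m / m`!%:R)).
apply: (@nondecreasing_cvgn_le _ (series (exp_coeff y))).
  apply: nondecreasing_series => n _ _; exact: exp_coeff_ge0.
exact: is_cvg_series_exp_coeff.
Qed.

(** From the rank D on, |y|^m <= 4^-D (4 |y|)^m, so the tail is at most 4^-D times a
    tail of the series of exp (4 |y|): geometric decay in D without any estimate
    of factorials. *)
Lemma exp_coeff_tail_le y D :
  `|expR y - \sum_(m < D) y ^+ m / m`!%:R| <= (4 ^+ D)^-1 * expR (4 * `|y|).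
Proof.
rewrite -(big_mkord xpredT (fun m => y ^+ m / m`!%:R)).
pose u N := `|series (exp_coeff y) N - series (exp_coeff y) D|.
have cu : u @ \oo --> `|expR y - series (exp_coeff y) D|.
  apply: cvg_norm; apply: cvgB; last exact: cvg_cst.
  exact: is_cvg_series_exp_coeff.
rewrite -[leLHS](cvg_lim _ cu)//; apply: limr_le.
  by apply/cvg_ex; eexists; exact: cu.
near=> N; have DN : (D <= N)%N by near: N; exact: nbhs_infty_ge.
rewrite /u sub_series_geq//; apply: (le_trans (ler_norm_sum _ _ _)).
apply: (@le_trans _ _ (\sum_(D <= m < N) (4 ^+ D)^-1 * ((4 * `|y|) ^+ m / m`!%:R))).
  rewrite big_nat_cond [leRHS]big_nat_cond; apply: ler_sum => m /andP[/andP[Dm _] _].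
  rewrite /exp_coeff/= normrM normfV normrX [`|_`!%:R|]ger0_norm// mulrA.
  rewrite ler_wpM2r ?invr_ge0// exprMn mulrA ler_peMl ?exprn_ge0//.
  by rewrite mulrC ler_pdivlMr ?exprn_gt0// mul1r ler_eXn2l// ltr1n.
rewrite -mulr_sumr ler_wpM2l ?invr_ge0 ?exprn_ge0//.
apply: le_trans (exp_coeff_sum_le_expR N _); last by rewrite mulr_ge0.
rewrite -(big_mkord xpredT (fun m => (4 * `|y|) ^+ m / m`!%:R)).
rewrite [leRHS](@big_cat_nat _ _ _ D)//= lerDr.
by apply: sumr_ge0 => m _; rewrite divr_ge0// exprn_ge0// mulr_ge0.
Unshelve. all: by end_near. Qed.

Lemma expR1_le4 : expR 1 <= 4 :> R.
Proof.
have h : 2^-1 <= expR (- 2^-1) :> R.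
  by apply: le_trans (expR_ge1Dx _); lra.
have -> : 1 = 2^-1 + 2^-1 :> R by field.
rewrite expRD; have e0 : 0 < expR 2^-1 :> R by exact: expR_gt0.
have ee : expR 2^-1 * expR (- 2^-1) = 1 :> R by rewrite -expRD subrr expR0.
have e2 : expR 2^-1 <= 2 :> R by nra.
nra.
Qed.

Definition gauss_kernel x t : R := expR (- (x - t) ^+ 2 / 2).

(** The power series of exp (x t) splits gauss_kernel x t into products of
    functions of x and of t. The scaling by 2 M keeps the t-part bounded by 1,
    and the t-part vanishes when |t| > 2 M. *)
Definition kernel_coef M m x : R :=
  (2 * M * x) ^+ m / m`!%:R * expR (- x ^+ 2 / 2).

Definition kernel_moment M m t : R :=
  \1_(`[- (2 * M), 2 * M]) t * ((t / (2 * M)) ^+ m * expR (- t ^+ 2 / 2)).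

Lemma gauss_kernel_le1 x t : gauss_kernel x t <= 1.
Proof. by rewrite -[leRHS]expR0 ler_expR; have := sqr_ge0 (x - t); lra. Qed.

Lemma kernel_moment_le1 M m t : 0 < M -> `|kernel_moment M m t| <= 1.
Proof.
move=> M0; rewrite /kernel_moment indicE mem_setE in_itv/= -ler_norml.
have [tM|tM] := leP `|t| (2 * M); last by rewrite mulr0n mul0r normr0.
rewrite mulr1n mul1r normrM mulr_ile1// ?normr_ge0//.
  rewrite normrX exprn_ile1// normrM normfV [X in _ / X]gtr0_norm ?mulr_gt0//.
  by rewrite ler_pdivrMr ?mulr_gt0// mul1r.
by rewrite ger0_norm ?expR_ge0// -[leRHS]expR0 ler_expR; have := sqr_ge0 t; lra.
Qed.

Lemma kernel_coef_sum M D x : 0 < M -> `|x| <= M ->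
  \sum_(m < D) `|kernel_coef M m x| <= expR (2 * M ^+ 2).
Proof.
move=> M0 xM; have M_ge0 := ltW M0.
apply: (@le_trans _ _ (\sum_(m < D) (2 * M * `|x|) ^+ m / m`!%:R)).
  apply: ler_sum => m _; rewrite /kernel_coef normrM normrM normrX normfV.
  rewrite [`|_`!%:R|]ger0_norm// normrM [`|2 * M|]gtr0_norm ?mulr_gt0//.
  rewrite ler_piMr ?divr_ge0 ?exprn_ge0 ?mulr_ge0//.
  by rewrite ger0_norm ?expR_ge0// -[leRHS]expR0 ler_expR; have := sqr_ge0 x; lra.
apply: le_trans (exp_coeff_sum_le_expR _ _) _.
  by rewrite !mulr_ge0.
by rewrite ler_expR expr2 mulrA ler_wpM2l// mulr_ge0.
Qed.

(** If |t| > 2 M the kernel itself is below the error since |x - t| >= M.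
    Otherwise |x t| <= 2 M^2, and the tail of the series is at most
    4^-D exp (8 M^2) <= exp (8 M^2 - D). *)
Lemma gauss_kernel_expansion M D x t : 0 < M -> 9 * M ^+ 2 <= D%:R ->
  `|x| <= M ->
  `|gauss_kernel x t - \sum_(m < D) kernel_coef M m x * kernel_moment M m t|
    <= expR (- M ^+ 2 / 2).
Proof.
move=> M0 DM xM.
rewrite /kernel_moment indicE mem_setE in_itv/= -ler_norml.
have [tM|tM] := leP `|t| (2 * M); last first.
  rewrite big1 ?subr0; last by move=> m _; rewrite mulr0n mul0r mulr0.
  rewrite ger0_norm ?expR_ge0// ler_expR.
  suff : M ^+ 2 <= (x - t) ^+ 2 by lra.
  rewrite -[leRHS]real_normK ?num_real// ler_sqr ?nnegrE ?normr_ge0 ?(ltW M0)//.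
  have := lerB_dist t x; rewrite distrC; lra.
rewrite (_ : \sum_(m < D) _ = expR (- x ^+ 2 / 2) * expR (- t ^+ 2 / 2) *
    \sum_(m < D) (x * t) ^+ m / m`!%:R); last first.
  rewrite mulr_sumr; apply: eq_bigr => m _; rewrite /kernel_coef mul1r.
  rewrite [LHS](_ : _ = expR (- x ^+ 2 / 2) * expR (- t ^+ 2 / 2) *
    ((2 * M * x) ^+ m * (t / (2 * M)) ^+ m / m`!%:R)); last by ring.
  rewrite -exprMn; congr (_ * (_ ^+ _ / _)).
  by field; rewrite gt_eqF.
rewrite /gauss_kernel.
have -> : - (x - t) ^+ 2 / 2 = (- x ^+ 2 / 2 + - t ^+ 2 / 2) + x * t by field.
rewrite expRD (expRD (- x ^+ 2 / 2)) -mulrBr normrM.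
rewrite ger0_norm ?mulr_ge0 ?expR_ge0// -expRD.
apply: (@le_trans _ _ (1 * ((4 ^+ D)^-1 * expR (4 * `|x * t|)))).
  apply: ler_pM; rewrite ?expR_ge0 ?exp_coeff_tail_le//.
  by rewrite -[leRHS]expR0 ler_expR; have := sqr_ge0 x; have := sqr_ge0 t; lra.
rewrite mul1r.
have xtM : `|x * t| <= 2 * M ^+ 2.
  rewrite normrM expr2 mulrCA; apply: ler_pM => //.
apply: (@le_trans _ _ (expR (- D%:R) * expR (8 * M ^+ 2))).
  apply: ler_pM; rewrite ?invr_ge0 ?exprn_ge0 ?expR_ge0//.
    rewrite expRN lef_pV2 ?posrE ?expR_gt0 ?exprn_gt0//.
    by rewrite -[D%:R]mulr1 expRM_natl lerXn2r ?nnegrE ?expR_ge0 ?expR1_le4.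
  by rewrite ler_expR; lra.
by rewrite -expRD ler_expR; have := sqr_ge0 M; lra.
Qed.

(** Telescoping: each b i is at most 2 in absolute value, and 1 + 2 * 3^n is at
    most 3^(n+1). *)
Lemma prod_dist_le n (a b : 'I_n -> R) (e : R) : 0 <= e <= 1 ->
  (forall i, `|a i| <= 1) -> (forall i, `|a i - b i| <= e) ->
  `|\prod_i a i - \prod_i b i| <= 3 ^+ n * e.
Proof.
move=> /andP[e0 e1]; elim: n a b => [|n IH] a b a1 ab.
  rewrite !big_ord0 subrr normr0 mul1r.
  exact: e0.
have ab' i := ab (lift ord0 i); have a1' i := a1 (lift ord0 i).
rewrite !big_ord_recl; set A := (X in a ord0 * X); set B := (X in b ord0 * X).
have AB : `|A - B| <= 3 ^+ n * e by exact: IH.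
have A1 : `|A| <= 1.
  by rewrite normr_prod; apply: prodr_ile1 => i _; rewrite normr_ge0 a1'.
have b2 : `|b ord0| <= 2.
  have := ab ord0; have := a1 ord0; have := ler_normB (a ord0) (a ord0 - b ord0).
  rewrite opprB addrC subrK; lra.
have -> : a ord0 * A - b ord0 * B = (a ord0 - b ord0) * A + b ord0 * (A - B).
  by ring.
apply: le_trans (ler_normD _ _) _; rewrite !normrM.
have h1 : `|a ord0 - b ord0| * `|A| <= e * 1 by exact: ler_pM.
have h2 : `|b ord0| * `|A - B| <= 2 * (3 ^+ n * e) by exact: ler_pM.
apply: le_trans (lerD h1 h2) _.
have : 1 * e <= 3 ^+ n * e by rewrite ler_wpM2r// exprn_ege1// ler1n.
by rewrite exprS; lra.
Qed.

End exp_kernel.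

(** * Gaussian densities on tuples *)

Section lebesgue_tuple_product.
Local Open Scope ereal_scope.
Context (R : realType).

(** Tonelli, one coordinate at a time, following the inductive construction of
    [lebesgue_tuple]. *)
Lemma integral_lebesgue_tuple_prod d (u : 'I_d -> R -> R) :
  (forall i, measurable_fun setT (u i)) -> (forall i x, (0 <= u i x)%R) ->
  \int[lebesgue_tuple R d]_x (\prod_i u i (tnth x i))%:E =
  \prod_i \int[lebesgue_measure]_y (u i y)%:E.
Proof.
elim: d u => [|d IH] u mu u0.
  rewrite big_ord0; under eq_integral do rewrite big_ord0.
  rewrite /= integral_dirac//.
  by rewrite diracT mul1e.
have mprod : measurable_fun setT
    (fun x : d.+1.-tuple R => (\prod_i u i (tnth x i))%:E).
  apply/measurable_EFinP; apply: measurable_prod => i _.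
  by apply: measurableT_comp => //; exact: measurable_tnth.
have prod0 (x : d.+1.-tuple R) : (0 <= \prod_i u i (tnth x i))%R.
  by apply: prodr_ge0 => i _.
transitivity (\int[lebesgue_measure \x lebesgue_tuple R d]_p
    (\prod_i u i (tnth (tcons p) i))%:E).
  rewrite /= ge0_integral_pushforward//; first exact: measurable_tcons.
  by move=> y _; rewrite lee_fin.
have mcons : measurable_fun setT
    (fun p : R * d.-tuple R => (\prod_i u i (tnth (tcons p) i))%:E).
  by apply: (measurableT_comp mprod); exact: measurable_tcons.
transitivity (\int[lebesgue_measure]_x \int[lebesgue_tuple R d]_t
    (\prod_i u i (tnth (tcons (x, t)) i))%:E).
  apply: (@fubini_tonelli1 _ _ _ _ R lebesgue_measure (lebesgue_tuple R d) _ mcons).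
  by move=> p; rewrite lee_fin.
rewrite big_ord_recl.
have tailE (x : R) (t : d.-tuple R) : (\prod_i u i (tnth (tcons (x, t)) i) =
    u ord0 x * \prod_i u (lift ord0 i) (tnth t i))%R.
  rewrite big_ord_recl; congr (_ * _)%R.
  by apply: eq_bigr => i _; rewrite tnthS.
under eq_integral => x _ do under eq_integral => t _ do rewrite tailE EFinM.
have mtail : measurable_fun setT
    (fun t : d.-tuple R => (\prod_i u (lift ord0 i) (tnth t i))%:E).
  apply/measurable_EFinP; apply: measurable_prod => i _.
  by apply: measurableT_comp => //; exact: measurable_tnth.
have inner x : \int[lebesgue_tuple R d]_t
      ((u ord0 x)%:E * (\prod_i u (lift ord0 i) (tnth t i))%:E) =
    (u ord0 x)%:E * \prod_i \int[lebesgue_measure]_y (u (lift ord0 i) y)%:E.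
  rewrite ge0_integralZl ?lee_fin//; last first.
    by move=> t _; rewrite lee_fin prodr_ge0.
  by rewrite -(IH (fun i => u (lift ord0 i))).
under eq_integral => x _ do rewrite inner.
rewrite ge0_integralZr//.
- by apply/measurable_EFinP; exact: mu.
- by move=> x _; rewrite lee_fin.
- by apply: prode_ge0 => i _; apply: integral_ge0 => x _; rewrite lee_fin.
Qed.

End lebesgue_tuple_product.

Section gaussian_density.
Context (R : realType) (d : nat).
Implicit Types x t a : d.-tuple R.

Lemma normal_constE :
  (2 * pi) `^ (- (d%:R / 2)) = \prod_(i < d) (Num.sqrt (2 * pi))^-1 :> R.
Proof.
have p0 : 0 <= 2 * pi :> R by rewrite mulr_ge0// pi_ge0.
rewrite (_ : - (d%:R / 2) = - 2^-1 * d%:R :> R); last by field.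
by rewrite powRrM powR_mulrn ?powR_ge0// powRN powR12_sqrt// prodr_const card_ord.
Qed.

Lemma sqrt_2pi_ge1 : 1 <= Num.sqrt (2 * pi) :> R.
Proof.
by rewrite -[leLHS]sqrtr1 ler_wsqrtr//; have := pi_ge2 R; lra.
Qed.

Lemma normal_const_gt0 : 0 < (2 * pi) `^ (- (d%:R / 2)) :> R.
Proof. by rewrite powR_gt0// mulr_gt0// pi_gt0. Qed.

Lemma normal_const_le1 : (2 * pi) `^ (- (d%:R / 2)) <= 1 :> R.
Proof.
rewrite normal_constE; apply: prodr_ile1 => i _; rewrite invr_ge0 sqrtr_ge0/=.
by rewrite invf_le1 ?sqrt_2pi_ge1// (lt_le_trans _ sqrt_2pi_ge1).
Qed.

Lemma std_normal_pdf_kernel x t : std_normal_pdf (tuple_sub x t) =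
  (2 * pi) `^ (- (d%:R / 2)) * \prod_i gauss_kernel (tnth x i) (tnth t i).
Proof.
rewrite /std_normal_pdf -expR_sum; congr (_ * expR _).
rewrite mulNr mulr_suml -sumrN; apply: eq_bigr => i _.
by rewrite tnth_mktuple mulNr.
Qed.

Lemma std_normal_pdf_gt0 x t : 0 < std_normal_pdf (tuple_sub x t).
Proof. by rewrite mulr_gt0 ?normal_const_gt0 ?expR_gt0. Qed.

Lemma std_normal_pdf_le1 x t : std_normal_pdf (tuple_sub x t) <= 1.
Proof.
rewrite std_normal_pdf_kernel mulr_ile1 ?normal_const_le1// ?powR_ge0//.
  by apply: prodr_ge0 => i _; exact: expR_ge0.
by apply: prodr_ile1 => i _; rewrite expR_ge0 gauss_kernel_le1.
Qed.

Lemma measurable_gauss_kernel2 dT (T : measurableType dT) (f g : T -> R) :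
  measurable_fun setT f -> measurable_fun setT g ->
  measurable_fun setT (fun z => gauss_kernel (f z) (g z)).
Proof.
move=> mf mg; apply: (measurableT_comp (@measurable_expR R)).
apply: measurable_funM => //; apply: measurable_funN.
by apply: measurable_funX; exact: measurable_funB.
Qed.

Lemma measurable_std_normal_pdf2 :
  measurable_fun [set: d.-tuple R * d.-tuple R]
    (fun p => std_normal_pdf (tuple_sub p.1 p.2)).
Proof.
under eq_fun do rewrite std_normal_pdf_kernel.
apply: measurable_funM => //; apply: measurable_prod => i _.
apply: measurable_gauss_kernel2.
  exact: (measurableT_comp (measurable_tnth i) measurable_fst).
exact: (measurableT_comp (measurable_tnth i) measurable_snd).
Qed.

Lemma measurable_std_normal_pdfr x :
  measurable_fun setT (fun t => std_normal_pdf (tuple_sub x t)).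
Proof.
exact: (measurableT_comp measurable_std_normal_pdf2 (measurable_pair1 x)).
Qed.

Lemma measurable_std_normal_pdfl t :
  measurable_fun setT (fun x => std_normal_pdf (tuple_sub x t)).
Proof.
exact: (measurableT_comp measurable_std_normal_pdf2 (measurable_pair2 t)).
Qed.

Lemma integral_std_normal_pdf t :
  (\int[lebesgue_tuple R d]_x (std_normal_pdf (tuple_sub x t))%:E = 1)%E.
Proof.
transitivity (\int[lebesgue_tuple R d]_x
    (\prod_i normal_pdf (tnth t i) 1 (tnth x i))%:E)%E.
  apply: eq_integral => x _; rewrite std_normal_pdf_kernel normal_constE.
  rewrite -big_split/=; congr EFin.
  apply: eq_bigr => i _; rewrite normal_pdfE ?oner_eq0//.
  rewrite /normal_peak /normal_fun /gauss_kernel expr1n mul1r.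
  by rewrite -[pi *+ 2]mulr_natl.
rewrite (@integral_lebesgue_tuple_prod _ _ (fun i => normal_pdf (tnth t i) 1)).
- by apply: big1 => i _; exact: integral_normal_pdf.
- by move=> i; exact: measurable_normal_pdf.
- by move=> i x; exact: normal_pdf_ge0.
Qed.

Definition cube a (M : R) : set (d.-tuple R) :=
  [set x | forall i, `|tnth x i - tnth a i| <= M].

Lemma measurable_cube a M : measurable (cube a M).
Proof.
rewrite (_ : cube a M = \bigcap_(i in [set: 'I_d])
    ((fun x => tnth x i) @^-1` `[tnth a i - M, tnth a i + M])); last first.
  apply/seteqP; split=> [x xM i _|x xM i].
    by rewrite /= in_itv/= -ler_distl xM.
  by have := xM i I; rewrite /= in_itv/= -ler_distl.
apply: fin_bigcap_measurable => [|i _]; first exact: finite_finset.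
rewrite -[X in measurable X]setTI.
by apply: measurable_tnth => //; exact: measurable_itv.
Qed.

Lemma lebesgue_tuple_cube a M : 0 <= M ->
  lebesgue_tuple R d (cube a M) = ((2 * M) ^+ d)%:E.
Proof.
move=> M0.
rewrite (_ : cube a M = [set x | forall i,
    `[tnth a i - M, tnth a i + M]%classic (tnth x i)]); last first.
  apply/seteqP; split=> [x xM i|x xM i].
    by rewrite /= in_itv/= -ler_distl xM.
  by have := xM i; rewrite /= in_itv/= -ler_distl.
rewrite (@lebesgue_tuple_box _ _
  (fun i => `[tnth a i - M, tnth a i + M]%classic))//.
under eq_bigr.
  move=> i _; rewrite lebesgue_measure_itv/= lte_fin.
  rewrite (_ : (if _ then _ else _) = (2 * M)%:E).
    over.
  case: ltP => h; first by rewrite -EFinB; congr EFin; ring.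
  by congr EFin; lra.
by rewrite prodEFin prodr_const card_ord.
Qed.

(** Outside the cube |x - t|^2 >= M^2, so exp (- |x - t|^2 / 2) is at most
    exp (- M^2 / 4) exp (- |x - t|^2 / 4): up to this factor the tail is the
    total mass of a product of normal densities of variance 2. *)
Lemma integral_std_normal_pdf_cubeC t M : 0 <= M ->
  (\int[lebesgue_tuple R d]_(x in ~` cube t M)
     (std_normal_pdf (tuple_sub x t))%:E <=
   (Num.sqrt 2 ^+ d * expR (- M ^+ 2 / 4))%:E)%E.
Proof.
move=> M0.
have s2 : Num.sqrt 2 != 0 :> R by rewrite gt_eqF// sqrtr_gt0.
(* the factor sqrt 2 matches the normalizing constants of variances 1 and 2 *)
pose u i y := Num.sqrt 2 * normal_pdf (tnth t i) (Num.sqrt 2) y.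
have uE i y : u i y = (Num.sqrt (2 * pi))^-1 * expR (- (y - tnth t i) ^+ 2 / 4).
  rewrite /u normal_pdfE// /normal_peak /normal_fun sqr_sqrtr// mulrA.
  congr (_ * expR (_ / _)).
    rewrite (_ : 2 * pi *+ 2 = 2 * (2 * pi)); last by ring.
    by rewrite sqrtrM// invfM mulrA divff// mul1r.
  by ring.
have mu i : measurable_fun setT (u i).
  by apply: measurable_funM => //; exact: measurable_normal_pdf.
have u0 i y : 0 <= u i y by rewrite mulr_ge0// normal_pdf_ge0.
have intu : (\int[lebesgue_tuple R d]_x (\prod_i u i (tnth x i))%:E =
    (Num.sqrt 2 ^+ d)%:E)%E.
  rewrite integral_lebesgue_tuple_prod//.
  under eq_bigr.
    move=> i _; under eq_integral do rewrite EFinM.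
    rewrite ge0_integralZl//; last 2 first.
    - by apply/measurable_EFinP; exact: measurable_normal_pdf.
    - by move=> y _; rewrite lee_fin normal_pdf_ge0.
    rewrite integral_normal_pdf mule1.
    over.
  by rewrite prodEFin prodr_const card_ord.
have mprod : measurable_fun setT
    (fun x : d.-tuple R => (\prod_i u i (tnth x i))%:E).
  apply/measurable_EFinP; apply: measurable_prod => i _.
  by apply: measurableT_comp => //; exact: measurable_tnth.
rewrite integral_mkcond mulrC EFinM -intu -ge0_integralZl//; last first.
  by move=> x _; rewrite lee_fin prodr_ge0.
apply: ge0_le_integral_lower => x.
  by rewrite patchE; case: ifP => // _; rewrite lee_fin ltW// std_normal_pdf_gt0.
rewrite patchE; case: ifPn => [|_]; last first.
  by rewrite -EFinM lee_fin mulr_ge0 ?expR_ge0// prodr_ge0.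
rewrite inE => /existsNP[j /negP]; rewrite -ltNge => Mj.
rewrite -EFinM lee_fin std_normal_pdf_kernel normal_constE.
under [in leRHS]eq_bigr do rewrite uE.
rewrite big_split/= mulrCA ler_wpM2l ?prodr_ge0//.
rewrite /gauss_kernel -!expR_sum -expRD ler_expR.
have h k : \sum_i - (tnth x i - tnth t i) ^+ 2 / k =
    - (\sum_i (tnth x i - tnth t i) ^+ 2) / k.
  by rewrite -mulr_suml sumrN.
rewrite !h; suff : M ^+ 2 <= \sum_i (tnth x i - tnth t i) ^+ 2 by lra.
rewrite (bigD1 j)//= -[leLHS]addr0 lerD ?sumr_ge0// => [|i _]; last exact: sqr_ge0.
by rewrite -[leRHS]real_normK ?num_real// ler_sqr ?nnegrE ?normr_ge0// ltW.
Qed.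

End gaussian_density.

(** * Gaussian mixtures *)

Section bounded_integrals.
Context (R : realType) dT (T : measurableType dT) (G : probability T R).

Lemma bounded_integrable (f : T -> R) (c : R) : measurable_fun setT f ->
  (forall t, `|f t| <= c) -> G.-integrable setT (EFin \o f).
Proof.
move=> mf fc; apply: measurable_bounded_integrable => //.
  by apply: (@le_lt_trans _ _ 1%E); [exact: probability_le1|exact: ltry].
exists c; split; first exact: num_real.
by move=> y cy t _; apply: le_trans (fc t) (ltW cy).
Qed.

Lemma Rintegral_le_bound (f : T -> R) (c : R) : measurable_fun setT f ->
  (forall t, `|f t| <= c) -> `|\int[G]_t f t| <= c.
Proof.
move=> mf fc; have fi := bounded_integrable mf fc.
apply: le_trans (le_normr_Rintegral _ fi) _ => //.
have <- : \int[G]_t c = c.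
  rewrite Rintegral_cst// -[RHS]mulr1; congr (c * _).
  by rewrite [X in fine X](_ : _ = 1%E)//; exact: probability_setT.
apply: le_Rintegral => //.
- exact: integrable_norm.
- by apply: (@bounded_integrable _ `|c|).
Qed.

Lemma Rintegral_lincomb (I : Type) (s : seq I) (u : I -> R) (f : I -> T -> R)
    (c : R) : (forall i, measurable_fun setT (f i)) ->
  (forall i t, `|f i t| <= c) ->
  \int[G]_t (\sum_(i <- s) u i * f i t) = \sum_(i <- s) u i * \int[G]_t f i t.
Proof.
move=> mf fc; elim: s => [|i s IH].
  by under eq_Rintegral do rewrite big_nil; rewrite big_nil Rintegral_cst// mul0r.
have ui j : G.-integrable setT (EFin \o (fun t => u j * f j t)).
  apply: (@bounded_integrable _ (`|u j| * c)); first exact: measurable_funM.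
  by move=> t; rewrite normrM ler_wpM2l.
under eq_Rintegral do rewrite big_cons.
rewrite RintegralD//; last first.
  apply: (@bounded_integrable _ (\sum_(i <- s) `|u i| * c)).
    by apply: measurable_sum => j; exact: measurable_funM.
  move=> t; apply: le_trans (ler_norm_sum _ _ _) _; apply: ler_sum => j _.
  by rewrite normrM ler_wpM2l.
rewrite IH big_cons RintegralZl//.
exact: bounded_integrable (fc i).
Qed.

End bounded_integrals.

Section gauss_mixture.
Context (R : realType) (d : nat).
Local Notation T := (d.-tuple R).
Implicit Types (G : probability T R) (x t a : T) (M : R).

Lemma std_normal_pdf_norm_le1 x t : `|std_normal_pdf (tuple_sub x t)| <= 1.
Proof. by rewrite gtr0_norm ?std_normal_pdf_gt0// std_normal_pdf_le1. Qed.

Lemma gauss_mixtureE G x : ((gauss_mixture G x)%:E =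
  \int[G]_t (std_normal_pdf (tuple_sub x t))%:E)%E.
Proof.
rewrite /gauss_mixture /Rintegral fineK//.
apply: integrable_fin_num => //.
exact: bounded_integrable (measurable_std_normal_pdfr x) (std_normal_pdf_norm_le1 x).
Qed.

(** A nonnegative function with null integral vanishes almost everywhere, which
    a positive function cannot do under a probability measure. *)
Lemma gauss_mixture_gt0 G x : 0 < gauss_mixture G x.
Proof.
rewrite lt0r; apply/andP; split; last first.
  by apply: Rintegral_ge0 => t _; rewrite ltW// std_normal_pdf_gt0.
apply/negP => /eqP G0; have := gauss_mixtureE G x; rewrite G0.
have mpdf := measurable_std_normal_pdfr x.
have -> : (\int[G]_t (std_normal_pdf (tuple_sub x t))%:E =
    \int[G]_t `|(std_normal_pdf (tuple_sub x t))%:E|)%E.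
  by apply: eq_integral => t _; rewrite gee0_abs// lee_fin ltW// std_normal_pdf_gt0.
move/esym/ae_eq_integral_abs; rewrite /= => /(_ measurableT).
have mE : measurable_fun setT (fun t => (std_normal_pdf (tuple_sub x t))%:E).
  exact/measurable_EFinP.
move=> /(_ mE) [N [mN N0 sub]].
have NT : N = setT.
  apply/seteqP; split => // t _; apply: sub => /= /(_ I).
  by move=> [/eqP]; rewrite gt_eqF// std_normal_pdf_gt0.
have : G setT = 1%E by exact: probability_setT.
by rewrite -NT N0 => /eqP; rewrite lt_eqF// lte01.
Qed.

Lemma measurable_gauss_mixture G : measurable_fun setT (gauss_mixture G).
Proof.
apply: (measurableT_comp (fine_measurable measurableT)).
apply: (@measurable_fun_fubini_tonelli_F _ _ _ _ _ G
  (fun p => (std_normal_pdf (tuple_sub p.1 p.2))%:E)).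
- by apply/measurable_EFinP; exact: measurable_std_normal_pdf2.
- by move=> p; rewrite lee_fin ltW// std_normal_pdf_gt0.
Qed.

Lemma integral_gauss_mixture G (D : set T) : measurable D ->
  (\int[lebesgue_tuple R d]_(x in D) (gauss_mixture G x)%:E =
   \int[G]_t \int[lebesgue_tuple R d]_(x in D)
     (std_normal_pdf (tuple_sub x t))%:E)%E.
Proof.
move=> mD.
pose f (p : T * T) : \bar R :=
  ((\1_D p.1 : R)%:E * (std_normal_pdf (tuple_sub p.1 p.2))%:E)%E.
have mf : measurable_fun setT f.
  apply: emeasurable_funM; apply/measurable_EFinP; last first.
    exact: measurable_std_normal_pdf2.
  by apply: measurableT_comp => //; exact: measurable_indic.
have f0 p : (0 <= f p)%E.
  by rewrite mule_ge0// lee_fin ltW// std_normal_pdf_gt0.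
transitivity (\int[lebesgue_tuple R d]_x \int[G]_t f (x, t))%E.
  rewrite integral_mkcond; apply: eq_integral => x _; rewrite /f/=.
  rewrite ge0_integralZl//; last 2 first.
  - by apply/measurable_EFinP; exact: measurable_std_normal_pdfr.
  - by move=> t _; rewrite lee_fin ltW// std_normal_pdf_gt0.
  rewrite -gauss_mixtureE patchE indicE; case: ifPn => _.
  - by rewrite mul1e.
  - by rewrite mul0e.
rewrite (@fubini_tonelli _ _ _ _ R (lebesgue_tuple R d) G f mf f0).
apply: eq_integral => t _; rewrite [RHS]integral_mkcond.
apply: eq_integral => x _; rewrite /f patchE indicE; case: ifPn => _.
- by rewrite mul1e.
- by rewrite mul0e.
Qed.

Lemma integral_gauss_mixture_le1 G :
  (\int[lebesgue_tuple R d]_x (gauss_mixture G x)%:E <= 1)%E.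
Proof.
rewrite integral_gauss_mixture//.
under eq_integral do rewrite integral_std_normal_pdf.
rewrite integral_cst// mul1e; exact: probability_le1.
Qed.

(** Each component centred in S has small mass outside B, and G does not charge
    the other components. *)
Lemma integral_gauss_mixture_tail G (S B : set T) (M : R) : 0 <= M ->
  measurable S -> measurable B -> G S = 1%E ->
  (forall a, S a -> cube a M `<=` B) ->
  (\int[lebesgue_tuple R d]_(x in ~` B) (gauss_mixture G x)%:E <=
    (Num.sqrt 2 ^+ d * expR (- M ^+ 2 / 4))%:E)%E.
Proof.
move=> M0 mS mB GS SB; set b := (X in (_ <= X%:E)%E).
have mCB : measurable (~` B) by exact: measurableC.
have mCS : measurable (~` S) by exact: measurableC.
have b0 : 0 <= b by rewrite mulr_ge0 ?exprn_ge0 ?expR_ge0.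
have pdf0 t x : (0 <= (std_normal_pdf (tuple_sub x t))%:E)%E.
  by rewrite lee_fin ltW// std_normal_pdf_gt0.
have mpdf t : measurable_fun setT (fun x => (std_normal_pdf (tuple_sub x t))%:E).
  by apply/measurable_EFinP; exact: measurable_std_normal_pdfl.
rewrite integral_gauss_mixture//.
apply: (@le_trans _ _ (\int[G]_t (b%:E + (\1_(~` S) t)%:E))%E).
  apply: ge0_le_integral_lower => t; first exact: integral_ge0.
  rewrite indicE; have [/set_mem /= tS|tS] := boolP (t \in ~` S).
    apply: (@le_trans _ _ 1%E); last by rewrite -EFinD lee_fin lerDr.
    rewrite -(integral_std_normal_pdf t).
    by apply: ge0_subset_integral => //.
  rewrite adde0; apply: le_trans (integral_std_normal_pdf_cubeC t M0).
  apply: ge0_subset_integral => //.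
  - by apply: measurableC; exact: measurable_cube.
  - exact: measurable_funTS.
  - by apply: subsetC; apply: SB; move: tS; rewrite notin_setE /= => /contrapT.
rewrite ge0_integralD//; last by apply/measurable_EFinP; exact: measurable_indic.
have GCS : G (~` S) = 0%E.
  have := @probability_setC _ _ _ G _ mS; rewrite GS subee//.
rewrite integral_cst// integral_indic// setIT [X in (_ + X)%E]GCS.
rewrite adde0 -[leRHS]mule1 lee_wpmul2l//; exact: probability_le1.
Qed.

Definition tensor_coef D M a (alpha : {ffun 'I_d -> 'I_D}) x : R :=
  \prod_i kernel_coef M (alpha i) (tnth x i - tnth a i).

Definition tensor_moment D M a (alpha : {ffun 'I_d -> 'I_D}) t : R :=
  \prod_i kernel_moment M (alpha i) (tnth t i - tnth a i).

Definition mixture_moment D M a G (alpha : {ffun 'I_d -> 'I_D}) : R :=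
  \int[G]_t tensor_moment M a alpha t.

Lemma measurable_kernel_moment M m : measurable_fun setT (@kernel_moment R M m).
Proof.
apply: measurable_funM; first exact: measurable_indic.
apply: measurable_funM.
  by apply: measurable_funX; exact: measurable_funM.
apply: (measurableT_comp (@measurable_expR R)); apply: measurable_funM => //.
by apply: measurable_funN; exact: measurable_funX.
Qed.

Lemma measurable_tensor_moment D M a (alpha : {ffun 'I_d -> 'I_D}) :
  measurable_fun setT (tensor_moment M a alpha).
Proof.
apply: measurable_prod => i _.
apply: (measurableT_comp (measurable_kernel_moment M _)).
by apply: measurable_funB => //; exact: measurable_tnth.
Qed.

Lemma tensor_moment_le1 D M a (alpha : {ffun 'I_d -> 'I_D}) t : 0 < M ->
  `|tensor_moment M a alpha t| <= 1.
Proof.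
move=> M0; rewrite normr_prod; apply: prodr_ile1 => i _.
by rewrite normr_ge0 kernel_moment_le1.
Qed.

Lemma mixture_moment_le1 D M a G (alpha : {ffun 'I_d -> 'I_D}) : 0 < M ->
  `|mixture_moment M a G alpha| <= 1.
Proof.
move=> M0; apply: Rintegral_le_bound; first exact: measurable_tensor_moment.
by move=> t; exact: tensor_moment_le1.
Qed.

(** This sum is the factor by which rounding errors of the moments can grow. *)
Lemma tensor_coef_sum D M a x : 0 < M -> cube a M x ->
  \sum_(alpha : {ffun 'I_d -> 'I_D}) `|tensor_coef M a alpha x| <=
  expR (2 * M ^+ 2) ^+ d.
Proof.
move=> M0 xM; under eq_bigr do rewrite normr_prod.
rewrite -(bigA_distr_bigA 
  (fun (i : 'I_d) (m : 'I_D) => `|kernel_coef M m (tnth x i - tnth a i)|)).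
rewrite -[X in _ ^+ X](card_ord d) -prodr_const; apply: ler_prod => i _.
by rewrite sumr_ge0//= kernel_coef_sum.
Qed.

(** The product over the coordinates of the one-dimensional expansions is a sum
    over the D^d multi-indices alpha; integrating in t against G leaves the
    moments of G as the only trace of G. *)
Lemma gauss_mixture_expansion D M a G x : 0 < M -> 9 * M ^+ 2 <= D%:R ->
  cube a M x ->
  `|gauss_mixture G x - (2 * pi) `^ (- (d%:R / 2)) *
      \sum_(alpha : {ffun 'I_d -> 'I_D})
        tensor_coef M a alpha x * mixture_moment M a G alpha|
  <= 3 ^+ d * expR (- M ^+ 2 / 2).
Proof.
move=> M0 DM xM; set c := _ `^ _.
have c0 : 0 <= c by exact: powR_ge0.
pose K t := \prod_i gauss_kernel (tnth x i) (tnth t i).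
pose A t := \sum_(alpha : {ffun 'I_d -> 'I_D})
  tensor_coef M a alpha x * tensor_moment M a alpha t.
have AE t : A t = \prod_i \sum_(m < D)
    kernel_coef M m (tnth x i - tnth a i) *
    kernel_moment M m (tnth t i - tnth a i).
  rewrite bigA_distr_bigA; apply: eq_bigr => alpha _.
  by rewrite /tensor_coef /tensor_moment -big_split.
have mK : measurable_fun setT K.
  apply: measurable_prod => i _; apply: measurable_gauss_kernel2 => //.
  exact: measurable_tnth.
have K1 t : `|K t| <= 1.
  rewrite normr_prod; apply: prodr_ile1 => i _.
  by rewrite normr_ge0/= ger0_norm ?expR_ge0// gauss_kernel_le1.
have mA : measurable_fun setT A.
  apply: measurable_sum => alpha; apply: measurable_funM => //.
  exact: measurable_tensor_moment.
have e1 : 0 <= expR (- M ^+ 2 / 2) <= 1.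
  rewrite expR_ge0/= -[leRHS]expR0 ler_expR.
  by have := sqr_ge0 M; lra.
have KA t : `|K t - A t| <= 3 ^+ d * expR (- M ^+ 2 / 2).
  rewrite AE; apply: prod_dist_le => // i.
    by rewrite ger0_norm ?expR_ge0// gauss_kernel_le1.
  rewrite (_ : gauss_kernel _ _ =
      gauss_kernel (tnth x i - tnth a i) (tnth t i - tnth a i)); last first.
    by rewrite /gauss_kernel; congr (expR (- _ ^+ 2 / 2)); ring.
  exact: gauss_kernel_expansion (xM i).
have Kint : G.-integrable setT (EFin \o K) by exact: bounded_integrable mK K1.
have Aint : G.-integrable setT (EFin \o A).
  apply: (@bounded_integrable _ _ _ _ _ (1 + 3 ^+ d * expR (- M ^+ 2 / 2))) => // t.
  rewrite -[A t](subKr (K t)); apply: le_trans (ler_normB _ _) _.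
  exact: lerD.
have -> : gauss_mixture G x = c * \int[G]_t K t.
  rewrite -RintegralZl//; apply: eq_Rintegral => t _.
  exact: std_normal_pdf_kernel.
have <- : \int[G]_t A t = \sum_(alpha : {ffun 'I_d -> 'I_D})
    tensor_coef M a alpha x * mixture_moment M a G alpha.
  apply: (@Rintegral_lincomb _ _ _ _ _ _ _ _ 1).
    by move=> alpha; exact: measurable_tensor_moment.
  by move=> alpha t; exact: tensor_moment_le1.
rewrite -mulrBr normrM ger0_norm// -RintegralB//.
apply: (@le_trans _ _ (1 * (3 ^+ d * expR (- M ^+ 2 / 2)))); last by rewrite mul1r.
apply: ler_pM => //; first exact: normal_const_le1.
by apply: Rintegral_le_bound => //; exact: measurable_funB.
Qed.

Lemma gauss_mixture_dist D M a (e : R) G G' x :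
  0 <= e -> 0 < M -> 9 * M ^+ 2 <= D%:R ->
  (forall alpha : {ffun 'I_d -> 'I_D},
     `|mixture_moment M a G alpha - mixture_moment M a G' alpha| <= e) ->
  cube a M x ->
  `|gauss_mixture G x - gauss_mixture G' x| <=
    2 * 3 ^+ d * expR (- M ^+ 2 / 2) + expR (2 * M ^+ 2) ^+ d * e.
Proof.
move=> e0 M0 DM Ge xM; set c := (2 * pi : R) `^ (- (d%:R / 2)).
have := gauss_mixture_expansion G M0 DM xM.
have := gauss_mixture_expansion G' M0 DM xM.
rewrite -/c; set s' := \sum_alpha _; set s := \sum_alpha _ => hG' hG.
have hs : `|c * s - c * s'| <= expR (2 * M ^+ 2) ^+ d * e.
  rewrite -mulrBr normrM ger0_norm ?powR_ge0//.
  apply: (@le_trans _ _ (1 * `|s - s'|)).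
    by rewrite ler_wpM2r// normal_const_le1.
  rewrite mul1r /s /s' -sumrB; apply: le_trans (ler_norm_sum _ _ _) _.
  apply: (@le_trans _ _ (\sum_(alpha : {ffun 'I_d -> 'I_D})
      `|tensor_coef M a alpha x| * e)).
    by apply: ler_sum => alpha _; rewrite -mulrBr normrM ler_wpM2l.
  rewrite -mulr_suml ler_wpM2r ?tensor_coef_sum//.
rewrite (_ : gauss_mixture G x - gauss_mixture G' x =
  (gauss_mixture G x - c * s) - (gauss_mixture G' x - c * s') + (c * s - c * s'));
  last by ring.
apply: le_trans (ler_normD _ _) _.
have := ler_normB (gauss_mixture G x - c * s) (gauss_mixture G' x - c * s').
by lra.
Qed.

End gauss_mixture.

(** * Finite nets of mixtures and averaged mixing measures *)

Section net.
Context (R : realType) (d : nat).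
Local Notation T := (d.-tuple R).

(** Mixing measures whose moments around every atom have the same integer parts
    after scaling by m form finitely many classes. Choosing a member of each
    class makes the net consist of mixtures, hence of measurable positive
    densities, where rounding the expansion itself would not. *)
Lemma gauss_mixture_net (G0 : probability T R) k (a : 'I_k -> T) (M : R) D m :
  0 < M -> 9 * M ^+ 2 <= D%:R -> (0 < m)%N ->
  exists rep : {ffun 'I_k * {ffun 'I_d -> 'I_D} -> 'I_(2 * m).+1} ->
               probability T R,
  forall G : probability T R, exists tau, forall j x, cube (a j) M x ->
    `|gauss_mixture G x - gauss_mixture (rep tau) x| <=
      2 * 3 ^+ d * expR (- M ^+ 2 / 2) + expR (2 * M ^+ 2) ^+ d * m%:R^-1.
Proof.
move=> M0 DM m0.
have mR0 : 0 < m%:R :> R by rewrite ltr0n.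
pose y (G : probability T R) (p : 'I_k * {ffun 'I_d -> 'I_D}) :=
  (mixture_moment M (a p.1) G p.2 + 1) * m%:R.
have yge0 G p : 0 <= y G p.
  rewrite mulr_ge0//; have := mixture_moment_le1 (a p.1) G p.2 M0.
  by rewrite ler_norml; lra.
have yle G p : y G p <= (2 * m)%:R.
  rewrite natrM ler_wpM2r//; have := mixture_moment_le1 (a p.1) G p.2 M0.
  by rewrite ler_norml; lra.
pose code G : {ffun 'I_k * {ffun 'I_d -> 'I_D} -> 'I_(2 * m).+1} :=
  [ffun p => inord (Num.truncn (y G p))].
have codeP G G' (p : 'I_k * {ffun 'I_d -> 'I_D}) : code G = code G' ->
    `|mixture_moment M (a p.1) G p.2 - mixture_moment M (a p.1) G' p.2| <=
    m%:R^-1.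
  move=> /ffunP/(_ p); rewrite !ffunE => /(congr1 val); rewrite /= !inordK.
  - move=> e; have /andP[l1 u1] := truncn_itv (yge0 G p).
    have /andP[l2 u2] := truncn_itv (yge0 G' p).
    have dy : `|y G p - y G' p| <= 1.
      rewrite e in l1 u1; rewrite -natr1 in u1; rewrite -natr1 in u2.
      by rewrite ler_norml; lra.
    rewrite -[leRHS]mul1r ler_pdivlMr//; apply: le_trans dy.
    rewrite -[X in _ * X]ger0_norm// -normrM /y.
    by rewrite le_eqVlt; apply/orP; left; apply/eqP; congr `|_|; ring.
  - by rewrite ltnS -(@ler_nat R); apply: le_trans (yle G' p); rewrite truncn_le.
  - by rewrite ltnS -(@ler_nat R); apply: le_trans (yle G p); rewrite truncn_le.
have /choice[rep repP] : forall tau, exists G,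
    (exists G', code G' = tau) -> code G = tau.
  move=> tau; have [[G' G'tau]|no] := pselect (exists G', code G' = tau).
    by exists G'.
  (* a code attained by no mixing measure gets an arbitrary representative *)
  by exists G0.
exists rep => G; exists (code G) => j x xj.
apply: gauss_mixture_dist DM _ xj => // alpha.
apply: (codeP _ _ (j, alpha)).
by rewrite repP//; exists G.
Qed.

End net.

Section average.
Local Open Scope ereal_scope.
Context dT (T : measurableType dT) (R : realType) (n : nat).
Variable G : 'I_n -> probability T R.

Lemma ge0_integral_average_measure (f : T -> \bar R) :
  measurable_fun setT f -> (forall x, 0 <= f x) ->
  \int[average_measure G]_x f x =
  (n%:R^-1)%:E * \sum_i \int[G i]_x f x.
Proof.
move=> mf f0.
pose G' k : {measure set T -> \bar R} :=
  if insub k is Some i then G i else mzero.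
rewrite (eq_measure_integral (mscale (n%:R^-1)%:nng%R (msum G' n))).
  rewrite ge0_integral_mscale// ge0_integral_measure_sum//; congr (_ * _).
  by apply: eq_bigr => i _; rewrite /G' valK.
move=> A mA _; rewrite /average_measure /mscale/=; congr (_ * _).
by apply: eq_bigr => i _; rewrite /G' valK.
Qed.

Lemma average_probability_exists : (0 < n)%N ->
  exists G0 : probability T R, forall A, G0 A = average_measure G A.
Proof.
move=> n0.
pose m := Measure_isProbability.Build _ _ _ (average_measure G)
  (average_measure_setT G n0).
pose G0 : probability T R := HB.pack (average_measure G) m.
by exists G0.
Qed.

End average.

(** * Rates *)

Section rate.
Context (R : realType).

Lemma ln_ge_half n : (2 <= n)%N -> 2^-1 <= ln n%:R :> R.
Proof.
move=> n2; have n0 : 0 < n%:R :> R by rewrite ltr0n (leq_trans _ n2).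
rewrite -ler_expR lnK ?posrE//; apply: (@le_trans _ _ 2); last by rewrite ler_nat.
have : expR 2^-1 * expR 2^-1 <= 4 :> R.
  by rewrite -expRD (_ : 2^-1 + 2^-1 = 1) ?expR1_le4//; field.
by have := expR_ge0 (2^-1 : R); nra.
Qed.

(** The five summands are the costs of the observations outside B, of the
    resolution eta of the net, of the slack 1/n, of the logarithm of the size
    of the net and of the constant added to it. *)
Definition npmle_rate_const d : R :=
  2 * 2 ^+ d * 2 ^+ d.+1 + 4 * 3 ^+ d.+1 * 8 ^+ d + 2 ^+ d.+1 +
  2 * (74 ^+ d * (16 * d + 6)%:R) + 2 * 2 ^+ d.+1.

Lemma npmle_rate_const_gt0 d : 0 < npmle_rate_const d.
Proof.
rewrite /npmle_rate_const; have p2 : 0 < 2 ^+ d.+1 :> R by rewrite exprn_gt0.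
have h1 : 0 <= 2 * 2 ^+ d * 2 ^+ d.+1 :> R by rewrite !mulr_ge0// ?exprn_ge0.
have h2 : 0 <= 4 * 3 ^+ d.+1 * 8 ^+ d :> R by rewrite !mulr_ge0// ?exprn_ge0.
have h3 : 0 <= 2 * (74 ^+ d * (16 * d + 6)%:R) :> R.
  by rewrite !mulr_ge0// ?exprn_ge0.
by lra.
Qed.

(** With Q = (k / n) L^(d+1) and L >= 1/2, both 1/n and (k / n) L^d are at most
    a constant times Q; the powers of 2 in the constant come from this. *)
Lemma npmle_rate_le d (n k : nat) (b eta v lnN : R) :
  (2 <= n)%N -> (1 <= k)%N ->
  b <= 2 ^+ d * n%:R ^- 2 -> 0 <= eta <= 3 ^+ d.+1 * n%:R ^- 4 ->
  0 <= v <= k%:R * (8 * ln n%:R) ^+ d ->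
  lnN <= k%:R * (74 * ln n%:R) ^+ d * ((16 * d + 6)%:R * ln n%:R) ->
  2 * n%:R * b + 2 * n%:R * eta * v + n%:R^-1 + 2 / n%:R * (lnN + 1) <=
  npmle_rate_const d * (k%:R / n%:R) * ln n%:R ^+ d.+1.
Proof.
move=> n2 k1 hb /andP[eta0 heta] /andP[v0 hv] hN.
have L2 := ln_ge_half n2; set L := ln n%:R in L2 hv hN *.
have L0 : 0 <= L by lra.
have n0 : 0 < n%:R :> R by rewrite ltr0n (leq_trans _ n2).
have nx : n%:R * n%:R^-1 = 1 :> R by rewrite divff// gt_eqF.
rewrite -exprVn in hb; rewrite -exprVn in heta.
set x := n%:R^-1 in nx hb heta *.
have x0 : 0 <= x by rewrite invr_ge0 ltW.
have x1 : x <= 1 by rewrite invf_le1// ler1n (leq_trans _ n2).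
have kR : 1 <= k%:R :> R by rewrite ler1n.
set K := k%:R in kR hv hN *.
pose Q := K * x * L ^+ d.+1.
have Ld0 : 0 <= L ^+ d by rewrite exprn_ge0.
have KxLd : K * x * L ^+ d <= 2 * Q.
  have -> : 2 * Q = K * x * L ^+ d * (2 * L) by rewrite /Q exprSr; ring.
  by rewrite ler_peMr ?mulr_ge0//; lra.
have xQ : x <= 2 ^+ d.+1 * Q.
  have -> : 2 ^+ d.+1 * Q = x * (K * (2 * L) ^+ d.+1).
    by rewrite /Q exprMn; ring.
  rewrite ler_peMr// -[leLHS]mulr1; apply: ler_pM => //.
  by rewrite exprn_ege1//; lra.
have t1 : 2 * n%:R * b <= 2 * 2 ^+ d * (2 ^+ d.+1 * Q).
  apply: (@le_trans _ _ (2 * 2 ^+ d * x)); last first.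
    by rewrite ler_wpM2l// mulr_ge0// exprn_ge0.
  have -> : 2 * 2 ^+ d * x = 2 * n%:R * (2 ^+ d * x ^+ 2).
    by transitivity (2 * 2 ^+ d * x * (n%:R * x)); [rewrite nx mulr1|ring].
  by rewrite ler_wpM2l ?mulr_ge0.
have t2 : 2 * n%:R * eta * v <= 4 * 3 ^+ d.+1 * 8 ^+ d * Q.
  apply: (@le_trans _ _ (2 * n%:R * (3 ^+ d.+1 * x ^+ 4) * (K * (8 * L) ^+ d))).
    apply: ler_pM => //; first by rewrite !mulr_ge0.
    by rewrite ler_wpM2l ?mulr_ge0.
  have -> : 2 * n%:R * (3 ^+ d.+1 * x ^+ 4) * (K * (8 * L) ^+ d) =
     2 * 3 ^+ d.+1 * 8 ^+ d * ((n%:R * x) * x ^+ 2 * (K * x * L ^+ d)).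
    by rewrite exprMn; ring.
  have -> : 4 * 3 ^+ d.+1 * 8 ^+ d * Q = 2 * 3 ^+ d.+1 * 8 ^+ d * (2 * Q) by ring.
  rewrite ler_wpM2l ?mulr_ge0 ?exprn_ge0// nx mul1r.
  apply: le_trans KxLd; rewrite ler_piMl ?mulr_ge0//.
  by rewrite exprn_ile1.
have t3 : 2 * x * lnN <= 2 * (74 ^+ d * (16 * d + 6)%:R) * Q.
  apply: (@le_trans _ _ (2 * x * (K * (74 * L) ^+ d * ((16 * d + 6)%:R * L)))).
    by rewrite ler_wpM2l ?mulr_ge0.
  by rewrite /Q exprSr exprMn le_eqVlt; apply/orP; left; apply/eqP; ring.
have -> : npmle_rate_const d * (K * x) * L ^+ d.+1 = npmle_rate_const d * Q.
  by rewrite /Q; ring.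
rewrite /npmle_rate_const mulrDr mulr1.
lra.
Qed.

End rate.

(** * The risk bound *)

Section likelihood.
Context (R : realType).

(** Mixtures are positive, so that sums of logarithms compare like products. *)
Lemma npmle_lik_prod d n (x : 'I_n -> d.-tuple R) (f g : d.-tuple R -> R) :
  (0 < n)%N -> is_npmle x f -> gauss_mixtures g ->
  \prod_i g (x i) <= \prod_i f (x i).
Proof.
move=> n0 [[F fE] fmax] Mg; have [G gE] := Mg.
have prodE (H : probability (d.-tuple R) R) :
    \prod_i gauss_mixture H (x i) = expR (\sum_i ln (gauss_mixture H (x i))).
  rewrite expR_sum; apply: eq_bigr => i _.
  by rewrite lnK// posrE gauss_mixture_gt0.
have := fmax _ Mg; rewrite /avg_loglik fE gE ler_pM2l ?invr_gt0 ?ltr0n//.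
by rewrite !prodE ler_expR.
Qed.

End likelihood.

Lemma card_eq_enum T (x0 : T) (S : set T) k : (S #= `I_k)%card ->
  exists a : nat -> T, forall x, S x <-> exists2 j, (j < k)%N & x = a j.
Proof.
move=> /card_set_bijP[f [fS finj fsurj]].
have /choice[a aP] j : exists x, (j < k)%N -> S x /\ f x = j.
  have [/fsurj[x Sx fx]|_] := boolP (j < k)%N; first by exists x.
  by exists x0.
exists a => x; split=> [Sx|[j jk ->]]; last by case: (aP _ jk).
have fx := fS _ Sx; exists (f x) => //.
by have [Sa fa] := aP _ fx; apply: finj; rewrite ?inE.
Qed.

Theorem theorem2p3 (R : realType) (d : nat) (hd : (1 <= d)%N) :
  exists2 C : R, 0 < C &
  forall (n : nat) (hn : (2 <= n)%N)
    (dO : measure_display) (Omega : measurableType dO)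
    (P : probability Omega R)
    (G : 'I_n -> probability (d.-tuple R) R)
    (X : 'I_n -> {RV P >-> d.-tuple R})
    (hindep : independent_RVs X)
    (hlaw : forall i, has_density (X i) (gauss_mixture (G i)))
    (fhat : Omega -> d.-tuple R -> R)
    (hfhat : forall w, is_npmle (fun i => X i w) (fhat w))
    (k : nat) (S : set (d.-tuple R))
    (hcard : (S #= `I_k)%card)
    (hsupp : average_measure G S = 1%E),
  (\int[P]_w hellinger2 (fhat w) (gauss_mixture (average_measure G)) <=
    (C * (k%:R / n%:R) * ln (n%:R : R) ^+ d.+1)%:E)%E.
Proof.
exists (npmle_rate_const R d); first exact: npmle_rate_const_gt0.
move=> n hn dO Omega P G X hindep hlaw fhat hfhat k S hcard hsupp.
have n_gt0 : (0 < n)%N by exact: leq_trans hn.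
have nR_gt0 : 0 < n%:R :> R by rewrite ltr0n.
have [G0 G0E] := average_probability_exists G n_gt0.
have f0E : gauss_mixture (average_measure G) = gauss_mixture G0.
  apply/funext => x; congr fine; apply: eq_measure_integral => A _ _.
  exact/esym/G0E.
rewrite f0E; set f0 := gauss_mixture G0.
have pdf0 x t : (0 <= (std_normal_pdf (@tuple_sub R d x t))%:E)%E.
  by rewrite lee_fin ltW// std_normal_pdf_gt0.
have f0_avg x : n%:R * f0 x = \sum_i gauss_mixture (G i) x.
  apply: EFin_inj; rewrite EFinM -sumEFin /f0 -f0E.
  rewrite f0E gauss_mixtureE.
  under eq_bigr do rewrite gauss_mixtureE.
  rewrite (eq_measure_integral (average_measure G)); last by move=> A _ _; exact: G0E.
  rewrite ge0_integral_average_measure//; last first.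
    by apply/measurable_EFinP; exact: measurable_std_normal_pdfr.
  by rewrite muleA -EFinM divff ?gt_eqF// mul1e.
have [a aP] := card_eq_enum [tuple (0 : R) | i < d] hcard.
pose L : R := ln n%:R.
have L2 : 2^-1 <= L by exact: ln_ge_half.
have L0 : 0 < L by lra.
have expL c : expR (c%:R * L) = n%:R ^+ c.
  by rewrite expRM_natl lnK ?posrE.
(* with M^2 = 8 L: exp (- M^2 / 2) = n^-4, exp (- M^2 / 4) = n^-2, and moments
   rounded to 1/m with m = n^(16 d + 4) absorb exp (2 d M^2) = n^(16 d) *)
pose M := Num.sqrt (8 * L).
have M0 : 0 < M by rewrite sqrtr_gt0 mulr_gt0.
have M2 : M ^+ 2 = 8 * L by rewrite sqr_sqrtr// mulr_ge0// ltW.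
have M8 : 2 * M <= 8 * L.
  rewrite -ler_sqr ?nnegrE ?mulr_ge0 ?(ltW M0) ?(ltW L0)// !exprMn M2; nra.
pose B := \big[setU/set0]_(j < k) cube (a j) M.
have mB : measurable B.
  by apply: bigsetU_measurable => j _; exact: measurable_cube.
have cubeB j : (j < k)%N -> cube (a j) M `<=` B.
  by move=> jk; exact: (bigsetU_sup (F := fun j => cube (a j) M)).
have mS : measurable S.
  (* a point is a cube of side 0 *)
  rewrite (_ : S = \big[setU/set0]_(j < k) cube (a j) 0).
    by apply: bigsetU_measurable => j _; exact: measurable_cube.
  apply/seteqP; split => x.
    move=> /aP[j jk ->].
    apply: (bigsetU_sup (F := fun j => cube (a j) 0) jk) => i.
    by rewrite subrr normr0.
  rewrite -(bigcup_mkord _ (fun j => cube (a j) 0)) => -[j jk xj].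
  apply/aP; exists j => //; apply: eq_from_tnth => i.
  by apply/eqP; rewrite -subr_eq0 -normr_le0.
have k_gt0 : (1 <= k)%N.
  rewrite lt0n; apply/eqP => k0; move: hcard; rewrite k0 II0 card_eq0 => /eqP S0.
  by move: hsupp; rewrite S0 measure0 => /eqP; rewrite lt_eqF// lte01.
pose D := (Num.truncn (72 * L)).+1.
have DM : 9 * M ^+ 2 <= D%:R.
  by rewrite M2 mulrA -natrM ltW// truncnS_gt.
have D74 : D%:R <= 74 * L.
  have : (Num.truncn (72 * L))%:R <= 72 * L by rewrite truncn_le mulr_ge0// ltW.
  by rewrite /D -natr1; lra.
pose m := (n ^ (16 * d + 4))%N.
have m_gt0 : (0 < m)%N by rewrite expn_gt0 n_gt0.
have [rep repP] := gauss_mixture_net G0 (fun j : 'I_k => a j) M0 DM m_gt0.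
pose eta := 2 * 3 ^+ d * expR (- M ^+ 2 / 2) + expR (2 * M ^+ 2) ^+ d * m%:R^-1.
pose v := k%:R * (2 * M) ^+ d.
pose b := Num.sqrt 2 ^+ d * expR (- M ^+ 2 / 4).
have eta0 : 0 <= eta.
  by rewrite addr_ge0 ?mulr_ge0 ?exprn_ge0 ?expR_ge0.
have v0 : 0 <= v by rewrite mulr_ge0 ?exprn_ge0 ?mulr_ge0 ?(ltW M0).
have Hrisk := @hellinger_risk_net R _ _ Omega _ P (lebesgue_tuple R d) n X
  (fun i => gauss_mixture (G i)) f0 B n_gt0 hindep
  (fun i => measurable_gauss_mixture (G i))
  (fun i x => ltW (gauss_mixture_gt0 (G i) x)) hlaw f0_avg
  (measurable_gauss_mixture G0) (gauss_mixture_gt0 G0) mB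
  (@gauss_mixtures R d) _ (fun tau => gauss_mixture (rep tau)) eta v b fhat.
apply: le_trans (Hrisk _ _ _ _ _ _ _ _) _ => //.
- move=> f [F ->]; split; first exact: measurable_gauss_mixture.
    exact: gauss_mixture_gt0.
  exact: integral_gauss_mixture_le1.
- by move=> tau; exists (rep tau).
- move=> f [F ->]; have [tau tauP] := repP F; exists tau => x.
  rewrite /B -(bigcup_mkord _ (fun j => cube (a j) M)) => -[j jk xj].
  exact: (tauP (Ordinal jk)).
- apply: le_trans (Boole_inequality (lebesgue_tuple R d)
    (A := fun j => cube (a j) M) _) _ => /=.
    by move=> j _; exact: measurable_cube.
  under eq_bigr do rewrite lebesgue_tuple_cube ?(ltW M0)//.
  by rewrite sumEFin sumr_const card_ord -[X in X%:E]mulr_natl.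
- apply: (integral_gauss_mixture_tail (ltW M0) mS mB).
    by rewrite -hsupp; exact: G0E.
  by move=> x /aP[j jk ->]; exact: cubeB.
- by move=> w; case: (hfhat w).
- by move=> w; apply: (npmle_lik_prod n_gt0 (hfhat w)); exists G0.
rewrite lee_fin; apply: npmle_rate_le => //.
- rewrite /b; apply: ler_pM; rewrite ?exprn_ge0 ?expR_ge0//.
    rewrite lerXn2r ?nnegrE//.
    by rewrite -[leRHS]ger0_norm// -sqrtr_sqr ler_wsqrtr//; lra.
  rewrite M2 (_ : - (8 * L) / 4 = - (2%:R * L)); last by field.
  by rewrite expRN expL.
- rewrite eta0/= /eta M2 (_ : - (8 * L) / 2 = - (4%:R * L)); last by field.
  rewrite expRN expL -expRM_natl (_ : d%:R * (2 * (8 * L)) = (16 * d)%:R * L); last first.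
    by rewrite natrM; ring.
  rewrite expL /m natrX exprD [in X in _ + X]invfM mulVKf; last first.
    by rewrite expf_neq0// gt_eqF.
  rewrite -[X in _ + X]mul1r -mulrDl ler_wpM2r ?invr_ge0 ?exprn_ge0//.
  have : 1 <= 3 ^+ d :> R by rewrite exprn_ege1// ler1n.
  by rewrite exprS; lra.
- rewrite v0/= /v ler_wpM2l// lerXn2r ?nnegrE ?mulr_ge0 ?(ltW M0) ?(ltW L0)//.
- set N := #|_|; have -> : N = ((2 * m).+1 ^ (k * D ^ d))%N.
    by rewrite /N card_ffun card_ord card_prod card_ord card_ffun !card_ord.
  have m1 : ln ((2 * m).+1%:R : R) <= (16 * d + 6)%:R * L.
    rewrite -[leRHS]expRK expL ler_ln ?posrE ?ltr0n ?exprn_gt0//.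
    rewrite -natrX ler_nat (_ : 16 * d + 6 = 16 * d + 4 + 2)%N; last by rewrite -addnA.
    rewrite expnD -/m; have n4 : (4 <= n ^ 2)%N by rewrite (@leq_sqr 2).
    apply: leq_trans (leq_mul (leqnn m) n4).
    by rewrite (_ : 4 = 2 + 2)%N// mulnDr (mulnC 2) -addn1 leq_add2l muln_gt0 m_gt0.
  rewrite natrX lnXn ?ltr0n// -[leLHS]mulr_natl natrM natrX.
  apply: ler_pM => //; first by rewrite ln_ge0// ler1n.
  by rewrite ler_wpM2l// lerXn2r ?nnegrE// mulr_ge0// ltW.
Qed.
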